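(* Let $\rho>0$ and let $f$ be the PQL function $$f(x)=a_{0}\prod_{k=1}^{N}(x-q_{k})^{M_{k}}a_{k}=a_0(x-q_1)^{M_1}a_1\cdots(x-q_N)^{M_N}a_N,$$ with $M_{k}\in\{\pm 1\}$, $0<|q_{k}|<\rho$ for every $k=1,\dots,N$, and $a_k\in\mathbb{H}\setminus\{0\}$ for every $k=0,\dots,N$. Then $$\frac{1}{|\partial \mathbb{B}_{\rho}|}\int_{\partial \mathbb{B}_{\rho}}\log|f(y)|\,d\sigma(y) = \frac{\rho^{2}}{8}\left(\sum_{k=1}^{N}M_{k}\frac{2}{|q_{k}|^{2}}\right)+\sum_{h=0}^{N}\log|a_{h}| +\sum_{k=1}^{N}M_{k}\left(\log\rho+\frac{1}{4}\,\frac{|q_{k}|^{4}-\rho^{4}}{\rho^{2}|q_{k}|^{2}}\right).$$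
   Context: $\mathbb{H}$ denotes the quaternions, identified with $\mathbb{R}^4$, with Euclidean norm $|\cdot|$; products are pointwise quaternionic products in the indicated order; repetitions among the $q_k$ and $a_k$ are allowed. $\mathbb{B}_\rho=\{x\in\mathbb{H}:|x|<\rho\}$, $d\sigma$ is the 3-dimensional surface measure on $\partial\mathbb{B}_\rho$ and $|\partial\mathbb{B}_\rho|$ is its total mass. *)

(* Defs.v *)
From HB Require Import structures.
From mathcomp Require Import all_boot all_order all_algebra.
From mathcomp Require Import all_classical all_reals all_analysis.
From mathcomp Require Import measurable_realfun ring lra.

Set Implicit Arguments.
Unset Strict Implicit.
Unset Printing Implicit Defensive.

Import Order.TTheory GRing.Theory Num.Theory.
Import numFieldNormedType.Exports.

Local Open Scope classical_set_scope.
Local Open Scope ring_scope.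

(* The quaternion t + x i + y j + z k is the tuple (t, x, y, z).  The type is a
   copy of R^4: it inherits the additive group and the (product Borel)
   sigma-algebra of R * R * R * R, but not its componentwise multiplication. *)
Definition quaternion (R : realType) : Type := (R * R * R * R)%type.

Section quaternion_ring.
Context {R : realType}.
Notation H := (quaternion R).

HB.instance Definition _ := Measurable.copy H (R * R * R * R)%type.
HB.instance Definition _ := GRing.Zmodule.copy H (R * R * R * R)%type.

Definition quat (t x y z : R) : H := (t, x, y, z).

Definition qt (p : H) : R := p.1.1.1.
Definition qx (p : H) : R := p.1.1.2.
Definition qy (p : H) : R := p.1.2.
Definition qz (p : H) : R := p.2.

Definition qdot (p q : H) : R :=
  qt p * qt q + qx p * qx q + qy p * qy q + qz p * qz q.

(* Euclidean norm; the library's norm on a product type is the sup norm. *)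
Definition qnorm (p : H) : R := Num.sqrt (qdot p p).

Definition qmul (p q : H) : H :=
  quat (qt p * qt q - qx p * qx q - qy p * qy q - qz p * qz q)
       (qt p * qx q + qx p * qt q + qy p * qz q - qz p * qy q)
       (qt p * qy q - qx p * qz q + qy p * qt q + qz p * qx q)
       (qt p * qz q + qx p * qy q - qy p * qx q + qz p * qt q).

Definition qone : H := quat 1 0 0 0.

(* conjugate over squared norm; in particular qinv 0 = 0 *)
Definition qinv (p : H) : H :=
  quat (qt p / qdot p p) (- qx p / qdot p p)
       (- qy p / qdot p p) (- qz p / qdot p p).

Lemma quatP (p q : H) :
  qt p = qt q -> qx p = qx q -> qy p = qy q -> qz p = qz q -> p = q.
Proof.
by case: p q => [[[? ?] ?] ?] [[[? ?] ?] ?]; rewrite /qt /qx /qy /qz /= => -> -> -> ->.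
Qed.

Lemma qmulA : associative qmul.
Proof. by move=> p q r; apply: quatP; rewrite /qmul /qt /qx /qy /qz /=; ring. Qed.

Lemma qmul1l : left_id qone qmul.
Proof. by move=> p; apply: quatP; rewrite /qmul /qt /qx /qy /qz /=; ring. Qed.

Lemma qmul1r : right_id qone qmul.
Proof. by move=> p; apply: quatP; rewrite /qmul /qt /qx /qy /qz /=; ring. Qed.

Lemma qmulDl : left_distributive qmul +%R.
Proof. by move=> p q r; apply: quatP; rewrite /qmul /qt /qx /qy /qz /=; ring. Qed.

Lemma qmulDr : right_distributive qmul +%R.
Proof. by move=> p q r; apply: quatP; rewrite /qmul /qt /qx /qy /qz /=; ring. Qed.

Lemma qone_neq0 : qone != 0.
Proof.
by apply/eqP => /(congr1 qt); rewrite /qt /= => /eqP; rewrite oner_eq0.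
Qed.

HB.instance Definition _ := GRing.Zmodule_isNzRing.Build H
  qmulA qmul1l qmul1r qmulDl qmulDr qone_neq0.

Lemma qdotpp_eq0 (p : H) : (qdot p p == 0) = (p == 0).
Proof.
apply/eqP/eqP => [|->]; last by rewrite /qdot /qt /qx /qy /qz /= !mul0r !addr0.
rewrite /qdot -!expr2 => h.
by apply: quatP; rewrite [RHS]/=; apply/eqP; rewrite -sqrf_eq0; apply/eqP; nra.
Qed.

Lemma qmulV (p : H) : p \in predC1 (0 : H) -> qinv p * p = 1.
Proof.
rewrite inE -qdotpp_eq0 => p0.
by apply: quatP; rewrite /GRing.mul /GRing.one /= /qmul /qone /qinv /= /qt /qx /qy /qz /=;
  move: p0; rewrite /qdot /qt /qx /qy /qz => p0; field.
Qed.

Lemma qmulrV (p : H) : p \in predC1 (0 : H) -> p * qinv p = 1.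
Proof.
rewrite inE -qdotpp_eq0 => p0.
by apply: quatP; rewrite /GRing.mul /GRing.one /= /qmul /qone /qinv /= /qt /qx /qy /qz /=;
  move: p0; rewrite /qdot /qt /qx /qy /qz => p0; field.
Qed.

Lemma qunitP (p q : H) : q * p = 1 /\ p * q = 1 -> predC1 (0 : H) p.
Proof.
move=> [+ _] /=; apply: contra_eqN => /eqP ->.
by rewrite mulr0 eq_sym oner_eq0.
Qed.

Lemma qinv_out : {in [predC predC1 (0 : H)], qinv =1 id}.
Proof.
move=> p; rewrite !inE negbK => /eqP ->.
by apply: quatP; rewrite /qinv /qt /qx /qy /qz /= ?oppr0 mul0r.
Qed.

HB.instance Definition _ := GRing.NzRing_hasMulInverse.Build H
  qmulV qmulrV qunitP qinv_out.

End quaternion_ring.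

Section sphere_surface_measure.
Context {R : realType}.
Notation H := (quaternion R).
Notation Rm := (measurableTypeR R).
Notation R3 := (Rm * Rm * Rm)%type.

(* The i-th partial derivative at t of a parametrized hypersurface of R^4; the
   factors of the parameter space are copies of R whose sigma-algebra is the
   one on which the library defines the Lebesgue measure. *)
Definition param_partial (Phi : R3 -> H) (t : R3) (i : 'I_3) : H :=
  let d (h : R -> H) (s : R) : H :=
    quat (derive1 (qt \o h) s) (derive1 (qx \o h) s)
         (derive1 (qy \o h) s) (derive1 (qz \o h) s) in
  let: (a, b, c) := t in
  [:: d (fun s => Phi (s, b, c)) a;
      d (fun s => Phi (a, s, c)) b;
      d (fun s => Phi (a, b, s)) c]`_i.

Definition gram (Phi : R3 -> H) (t : R3) : 'M[R]_3 :=
  \matrix_(i, j) qdot (param_partial Phi t i) (param_partial Phi t j).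

Definition area_element (Phi : R3 -> H) (t : R3) : R :=
  Num.sqrt (\det (gram Phi t)).

(* for 0 < rho, the boundary of the ball {x | qnorm x < rho} *)
Definition qsphere (rho : R) : set H := [set x | qnorm x = rho].

(* Hyperspherical coordinates: a bijection from the open box
   ]0, pi[ x ]0, pi[ x ]0, 2 pi[ to the sphere of radius rho minus the half
   great 2-sphere {qz = 0, 0 <= qy}. *)
Definition sphere_param (rho : R) (t : R3) : H :=
  let: (a, b, c) := t in
  quat (rho * cos a) (rho * (sin a * cos b))
       (rho * (sin a * sin b * cos c)) (rho * (sin a * sin b * sin c)).

Definition sphere_box : set R3 :=
  `[0, pi] `*` `[0, pi] `*` `[0, 2 * pi].

Definition lebesgue3 : {measure set R3 -> \bar R} :=
  ((@lebesgue_measure R \x @lebesgue_measure R) \x @lebesgue_measure R)%E.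

(* The 3-dimensional surface measure of the sphere of radius rho >= 0, as a
   Borel measure on the quaternions carried by [qsphere rho]: the image under
   the parametrization of sqrt(det(Gram)) dt.  See [sphere_area_element] for
   the closed form of the density; the boundary of the box is negligible. *)
Definition sphere_measure (rho : R) (A : set H) : \bar R :=
  (\int[lebesgue3]_(t in sphere_box `&` sphere_param rho @^-1` A)
     (area_element (sphere_param rho) t)%:E)%E.

Lemma qnorm_sphere_param (rho : R) t :
  0 <= rho -> qnorm (sphere_param rho t) = rho.
Proof.
move=> rho0; case: t => [[a b] c]; rewrite /qnorm.
suff -> : qdot (sphere_param rho (a, b, c)) (sphere_param rho (a, b, c))
          = rho ^+ 2 by rewrite sqrtr_sqr ger0_norm.
rewrite /qdot /qt /qx /qy /qz /=.
have ca := cos2Dsin2 a; have cb := cos2Dsin2 b; have cc := cos2Dsin2 c.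
transitivity (rho ^+ 2 * (cos a ^+ 2 + sin a ^+ 2 * (cos b ^+ 2 +
  sin b ^+ 2 * (cos c ^+ 2 + sin c ^+ 2)))); first by ring.
by rewrite cc mulr1 cb mulr1 ca mulr1.
Qed.

Lemma derive1_cosM (k u : R) :
  derive1 (fun s => k * (cos s * u)) = fun s => - (k * (sin s * u)).
Proof.
apply/funext => s; rewrite derive1E.
have -> : (fun s0 => k * (cos s0 * u)) = (k * u) \*: (cos : R -> R^o).
  by apply/funext => x /=; rewrite /GRing.scale /=; ring.
by rewrite deriveZ// derive_val /GRing.scale/=; ring.
Qed.

Lemma derive1_sinM (k u : R) :
  derive1 (fun s => k * (sin s * u)) = fun s => k * (cos s * u).
Proof.
apply/funext => s; rewrite derive1E.
have -> : (fun s0 => k * (sin s0 * u)) = (k * u) \*: (sin : R -> R^o).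
  by apply/funext => x /=; rewrite /GRing.scale /=; ring.
by rewrite deriveZ// derive_val /GRing.scale/=; ring.
Qed.

Lemma sphere_area_element (rho : R) a b c :
  area_element (sphere_param rho) (a, b, c) =
  `|rho| ^+ 3 * sin a ^+ 2 * `|sin b|.
Proof.
have p0 : param_partial (sphere_param rho) (a, b, c) 0 =
    quat (- (rho * sin a)) (rho * (cos a * cos b))
      (rho * (cos a * sin b * cos c)) (rho * (cos a * sin b * sin c)).
  apply: quatP; rewrite /param_partial /qt /qx /qy /qz /=.
  - rewrite (_ : _ \o _ = fun s => rho * (cos s * 1)) ?derive1_cosM ?mulr1//.
    by apply/funext => s /=; rewrite mulr1.
  - by rewrite (_ : _ \o _ = fun s => rho * (sin s * cos b)) ?derive1_sinM.
  - rewrite (_ : _ \o _ = fun s => rho * (sin s * (sin b * cos c))).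
      by rewrite derive1_sinM /=; ring.
    by apply/funext => s /=; ring.
  - rewrite (_ : _ \o _ = fun s => rho * (sin s * (sin b * sin c))).
      by rewrite derive1_sinM /=; ring.
    by apply/funext => s /=; ring.
have p1 : param_partial (sphere_param rho) (a, b, c) 1 =
    quat 0 (- (rho * (sin a * sin b)))
      (rho * (sin a * cos b * cos c)) (rho * (sin a * cos b * sin c)).
  apply: quatP; rewrite /param_partial /qt /qx /qy /qz /=.
  - by rewrite (_ : _ \o _ = cst (rho * cos a)) ?derive1_cst.
  - rewrite (_ : _ \o _ = fun s => rho * (cos s * sin a)) ?derive1_cosM.
      by rewrite (mulrC (sin a)).
    by apply/funext => s /=; rewrite (mulrC (sin a)).
  - rewrite (_ : _ \o _ = fun s => rho * (sin s * (sin a * cos c))).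
      by rewrite derive1_sinM /=; ring.
    by apply/funext => s /=; ring.
  - rewrite (_ : _ \o _ = fun s => rho * (sin s * (sin a * sin c))).
      by rewrite derive1_sinM /=; ring.
    by apply/funext => s /=; ring.
have p2 : param_partial (sphere_param rho) (a, b, c) 2 =
    quat 0 0 (- (rho * (sin a * sin b * sin c))) (rho * (sin a * sin b * cos c)).
  apply: quatP; rewrite /param_partial /qt /qx /qy /qz /=.
  - by rewrite (_ : _ \o _ = cst (rho * cos a)) ?derive1_cst.
  - by rewrite (_ : _ \o _ = cst (rho * (sin a * cos b))) ?derive1_cst.
  - rewrite (_ : _ \o _ = fun s => rho * (cos s * (sin a * sin b))).
      by rewrite derive1_cosM /=; ring.
    by apply/funext => s /=; ring.
  - rewrite (_ : _ \o _ = fun s => rho * (sin s * (sin a * sin b))).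
      by rewrite derive1_sinM /=; ring.
    by apply/funext => s /=; ring.
have ca := cos2Dsin2 a; have cb := cos2Dsin2 b; have cc := cos2Dsin2 c.
have e : gram (sphere_param rho) (a, b, c) =
    diag_mx (\row_(i < 3) [:: rho ^+ 2; rho ^+ 2 * sin a ^+ 2;
                              rho ^+ 2 * sin a ^+ 2 * sin b ^+ 2]`_i).
  apply/matrixP => i j; rewrite !mxE.
  have I3 (k : 'I_3) : [\/ k = 0, k = 1 | k = 2].
    case: k => [[|[|[|//]]] ?]; [apply: Or31|apply: Or32|apply: Or33];
      exact: val_inj.
  have sc2 (x : R) : cos x ^+ 2 = 1 - sin x ^+ 2.
    by rewrite -(cos2Dsin2 x) addrK.
  by case: (I3 i) => ->; case: (I3 j) => ->; rewrite ?p0 ?p1 ?p2 /qdot /qt /qx /qy /qz /=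
    ?mulr1n ?mulr0n; move: (sc2 a) (sc2 b) (sc2 c) => ha hb hc; ring: ha hb hc.
rewrite /area_element e det_diag !big_ord_recl big_ord0 !mxE /=.
rewrite (_ : rho ^+ 2 * (_ * _) = (rho ^+ 3 * sin a ^+ 2 * sin b) ^+ 2); last by ring.
by rewrite sqrtr_sqr 2!normrM normrX (ger0_norm (sqr_ge0 (sin a))).
Qed.

Lemma measurable_area_element (rho : R) :
  measurable_fun [set: R3] (area_element (sphere_param rho)).
Proof.
rewrite (_ : area_element _ = fun t => `|rho| ^+ 3 * sin t.1.1 ^+ 2 * `|sin t.1.2|);
  last by apply/funext => -[[a b] c]; rewrite sphere_area_element.
have m1 : measurable_fun [set: R3] (fun t => t.1.1) by exact: measurableT_comp.
have m2 : measurable_fun [set: R3] (fun t => t.1.2) by exact: measurableT_comp.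
have ms : measurable_fun [set: R] (@sin R).
  apply: continuous_measurable_fun; exact: continuous_sin.
apply: measurable_funM; last by do 2 apply: measurableT_comp => //.
by apply: measurable_funM => //; apply: measurable_funX; exact: measurableT_comp.
Qed.

Lemma measurable_sphere_param (rho : R) :
  measurable_fun [set: R3] (sphere_param rho).
Proof.
have ms : measurable_fun [set: R] (@sin R).
  apply: continuous_measurable_fun; exact: continuous_sin.
have mc : measurable_fun [set: R] (@cos R).
  apply: continuous_measurable_fun; exact: continuous_cos.
have m1 : measurable_fun [set: R3] (fun t => t.1.1) by exact: measurableT_comp.
have m2 : measurable_fun [set: R3] (fun t => t.1.2) by exact: measurableT_comp.
have m3 : measurable_fun [set: R3] (fun t => t.2) by exact: measurable_snd.
rewrite (_ : sphere_param rho = fun t =>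
   (rho * cos t.1.1, rho * (sin t.1.1 * cos t.1.2),
    rho * (sin t.1.1 * sin t.1.2 * cos t.2),
    rho * (sin t.1.1 * sin t.1.2 * sin t.2))); last by apply/funext => -[[]].
by do 3 ?[apply: measurable_fun_pair => /=];
  repeat (apply: measurable_funM => //=); exact: measurableT_comp.
Qed.

Lemma measurable_sphere_box : measurable (sphere_box : set R3).
Proof. apply: measurableX; [apply: measurableX|]; exact: measurable_itv. Qed.

Let mpre rho (A : set H) : measurable A ->
  measurable (sphere_box `&` sphere_param rho @^-1` A).
Proof.
move=> mA; apply: measurableI; first exact: measurable_sphere_box.
by rewrite -[X in measurable X]setTI; exact: measurable_sphere_param.
Qed.

Let sphere_measure0 rho : sphere_measure rho (set0 : set H) = 0%E.
Proof. by rewrite /sphere_measure preimage_set0 setI0 integral_set0. Qed.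

Let sphere_measure_ge0 rho (A : set H) : (0 <= sphere_measure rho A)%E.
Proof. by apply: integral_ge0 => t _; rewrite lee_fin sqrtr_ge0. Qed.

Let sphere_measure_sigma_additive rho :
  semi_sigma_additive (sphere_measure rho : set H -> \bar R).
Proof.
move=> F mF tF mUF; rewrite /sphere_measure preimage_bigcup setI_bigcupr.
rewrite ge0_integral_bigcup//=.
- by apply: is_cvg_ereal_nneg_natsum_cond => // n _ _; exact: sphere_measure_ge0.
- by move=> n; exact: mpre.
- apply: measurable_funTS; apply/measurable_EFinP.
  exact: measurable_area_element.
- by move=> t _; rewrite lee_fin sqrtr_ge0.
- apply/trivIsetP => /= i j _ _ ij; rewrite setIACA -preimage_setI.
  by move/trivIsetP : tF => /(_ _ _ _ _ ij) -> //; rewrite preimage_set0 setI0.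
Qed.

HB.instance Definition _ rho := isMeasure.Build _ _ _ (sphere_measure rho)
  (sphere_measure0 rho) (@sphere_measure_ge0 rho)
  (@sphere_measure_sigma_additive rho).

End sphere_surface_measure.

(* The coefficients a_0, ..., a_N are [a ord0] and [a (lift ord0 k)], k < N;
   the factors q_1, ..., q_N and M_1, ..., M_N are indexed from 0.  [\prod] is
   the ordered product of the noncommutative ring of quaternions. *)
Definition pql (R : realType) (N : nat) (a : 'I_N.+1 -> quaternion R)
    (q : 'I_N -> quaternion R) (M : 'I_N -> int) (x : quaternion R) :
    quaternion R :=
  a ord0 * \prod_(k < N) ((x - q k) ^ M k * a (lift ord0 k)).

(* Main.v *)
From HB Require Import structures.
Require Import Defs.
From mathcomp Require Import all_boot all_order all_algebra.
From mathcomp Require Import all_classical all_reals all_analysis.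
From mathcomp Require Import measurable_realfun ring lra.

(* Taking logarithms turns the PQL function into the sum of the [ln |a_h|] and
   of the [M_k ln |y - q_k|], so it suffices to compute the mean of
   [ln |y - q|] over the sphere; it equals [ln rho + |q|^2 / (4 rho^2)].
   Scaling to the unit sphere and writing [n = |q|], this is an integral of
   [ln (1 + n^2 - 2 <w, q>)] over the coordinate box.  When [q] moves along a
   circle in a coordinate plane, the derivative of the integrand is a divergence
   in the hyperspherical coordinates (rotations are generated by
   divergence-free fields), so the integral does not change; three such
   rotations bring [q] to [(s, 0, 0, 0)].  When [s] varies, the derivative of
   [ln (1 + s^2 - 2 s cos a) - s^2 / 2], times [sin a ^ 2], is again an exact
   derivative in [a] vanishing at both ends, with an explicit primitive
   involving [atan (s sin a / (1 - s cos a))]; at [s = 0] the integral is 0. *)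

Set Implicit Arguments.
Unset Strict Implicit.
Unset Printing Implicit Defensive.

Import Order.TTheory GRing.Theory Num.Theory.
Import numFieldNormedType.Exports.

Local Open Scope classical_set_scope.
Local Open Scope ring_scope.

(** * Integration against an image measure with a density *)

Section density.
Local Open Scope ereal_scope.
Context d1 d2 (X : measurableType d1) (Y : measurableType d2) (R : realType).
Variables (mu : {measure set X -> \bar R}) (nu : {measure set Y -> \bar R}).
Variables (phi : X -> Y) (mphi : measurable_fun [set: X] phi).
Variables (D : set X) (mD : measurable D).
Variables (g : X -> R) (mg : measurable_fun D g).
Hypothesis g0 : forall x, (0 <= g x)%R.
Hypothesis nuE : forall A, measurable A ->
  nu A = \int[mu]_(x in D `&` phi @^-1` A) (g x)%:E.

Import HBNNSimple.

Let mpre A : measurable A -> measurable (phi @^-1` A).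
Proof. by move=> mA; rewrite -[X in measurable X]setTI; exact: mphi. Qed.

(** Both sides are finite sums over the values of [h]; on each level set the identity is [nuE]. *)
Let integral_density_nnsfun (h : {nnsfun Y >-> R}) :
  \int[nu]_y (h y)%:E = \int[mu]_(x in D) ((h (phi x))%:E * (g x)%:E).
Proof.
rewrite integralT_nnsfun sintegralE.
transitivity (\sum_(r \in range h)
    \int[mu]_(x in D) ((r * \1_(h @^-1` [set r]) (phi x))%:E * (g x)%:E)).
  apply: eq_fsbigr => r; rewrite inE => -[y _ <-{r}].
  have mh : measurable (h @^-1` [set h y]) by [].
  have -> : (fun x => ((h y * \1_(h @^-1` [set h y]) (phi x))%:E * (g x)%:E)) =
      (fun x => (h y)%:E * ((g x)%:E * (\1_(phi @^-1` (h @^-1` [set h y])) x)%:E)).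
    by apply/funext => x; rewrite EFinM -muleA (muleC (g x)%:E) !indicE.
  rewrite ge0_integralZl//=; last 3 first.
  - apply: emeasurable_funM; apply/measurable_EFinP => //.
    by apply: measurable_indic; exact: mpre.
  - by move=> x _; rewrite mule_ge0// lee_fin.
  - by rewrite lee_fin.
  rewrite nuE// [X in _ * X]integral_mkcondr//; congr (_ * _).
  by apply: eq_integral => x _; rewrite patchE indicE; case: ifPn;
    rewrite ?mule1 ?mule0.
rewrite -ge0_integral_fsum//=.
- apply: eq_integral => x _; rewrite -ge0_mule_fsuml.
    by rewrite fsumEFin// -fimfunE.
  by move=> r; rewrite EFinM nnfun_muleindic_ge0.
- move=> r; apply: emeasurable_funM; apply/measurable_EFinP => //.
  apply: measurable_funM => //; apply: measurable_funTS.
  exact: measurableT_comp.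
- by move=> r x _; rewrite mule_ge0 ?lee_fin// -lee_fin EFinM nnfun_muleindic_ge0.
Qed.

(** Monotone convergence on both sides, along an increasing sequence of simple functions. *)
Lemma ge0_integral_density (f : Y -> \bar R) :
  measurable_fun [set: Y] f -> (forall y, 0 <= f y) ->
  \int[nu]_y f y = \int[mu]_(x in D) (f (phi x) * (g x)%:E).
Proof.
move=> mf f0; pose h := nnsfun_approx measurableT mf.
have nd y m n : (m <= n)%N -> (h m y <= h n y)%R.
  by move=> mn; exact/lefP/nd_nnsfun_approx.
have cvh y : (h n y)%:E @[n --> \oo] --> f y.
  by apply: cvg_nnsfun_approx => // *; exact: f0.
transitivity (limn (fun n => \int[nu]_y (h n y)%:E)).
  rewrite -monotone_convergence//.
  - by apply: eq_integral => y _; apply/esym/cvg_lim => //.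
  - by move=> n; exact/measurable_EFinP.
  - by move=> n y _; rewrite lee_fin.
  - by move=> y _ m n mn; rewrite lee_fin nd.
rewrite [X in limn X](_ : _ =
    (fun n => \int[mu]_(x in D) ((h n (phi x))%:E * (g x)%:E))); last first.
  by apply/funext => n; exact: integral_density_nnsfun.
rewrite -monotone_convergence//.
- apply: eq_integral => x _; apply/cvg_lim => //.
  exact: cvgeZr.
- move=> n; apply: emeasurable_funM; apply/measurable_EFinP => //.
  by apply: measurable_funTS; exact: measurableT_comp.
- by move=> n x _; rewrite mule_ge0// lee_fin.
- by move=> x _ m n mn; apply: lee_wpmul2r; rewrite lee_fin// nd.
Qed.

(** The positive and negative parts of [f], extended by zero off [E], are treated separately. Since
    [phi] maps [D] into [E], the extension is invisible on the right-hand side. *)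
Lemma integral_density (E : set Y) (f : Y -> \bar R) :
  measurable E -> (forall x, D x -> E (phi x)) ->
  measurable_fun [set: Y] f ->
  \int[nu]_(y in E) f y = \int[mu]_(x in D) (f (phi x) * (g x)%:E).
Proof.
move=> mE DE mf; rewrite integral_mkcond.
have mfE : measurable_fun [set: Y] (f \_ E).
  by apply/(measurable_restrictT _ mE); exact: measurable_funTS.
rewrite integralE ge0_integral_density//; last exact: measurable_funepos.
rewrite ge0_integral_density//; last exact: measurable_funeneg.
rewrite [RHS]integralE; congr (_ - _); apply: eq_integral => x /[!inE] /DE Ex.
- rewrite !funeposE patchE mem_set//.
  by rewrite maxe_pMl ?lee_fin// mul0e.
- rewrite !funenegE patchE mem_set//.
  by rewrite maxe_pMl ?lee_fin// mul0e mulNe.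
Qed.

End density.

(** * Vanishing of integrals over rectangles by Fubini *)

Section fubini_eq0.
Local Open Scope ereal_scope.
Context d1 d2 (T1 : measurableType d1) (T2 : measurableType d2) (R : realType).
Variable m1 : {sigma_finite_measure set T1 -> \bar R}.
Variable m2 : {sigma_finite_measure set T2 -> \bar R}.
Variables (A : set T1) (B : set T2) (f : T1 * T2 -> \bar R).
Hypotheses (mA : measurable A) (mB : measurable B).
Hypothesis intf : (m1 \x m2).-integrable (A `*` B) f.

Let mAB : measurable (A `*` B). Proof. exact: measurableX. Qed.

Let intfAB : (m1 \x m2).-integrable setT (f \_ (A `*` B)).
Proof. by apply/integrable_restrict => //; rewrite setTI. Qed.

(** With [f] extended by zero off the rectangle, Fubini gives an iterated integral whose inner
    integrals all vanish. *)
Lemma integral_setX_eq0_snd :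
  (forall x, A x -> \int[m2]_(y in B) f (x, y) = 0) ->
  \int[m1 \x m2]_(z in A `*` B) f z = 0.
Proof.
move=> fB0; rewrite integral_mkcond -integral12_prod_meas1//.
apply: integral0_eq => x _; rewrite /fubini_F.
have [Ax|nAx] := pselect (A x).
  rewrite -[RHS](fB0 _ Ax) [RHS]integral_mkcond; apply: eq_integral => y _.
  by rewrite !patchE /= in_setX/= (mem_set Ax).
apply: integral0_eq => y _; rewrite patchE memNset//= => -[].
by [].
Qed.

Lemma integral_setX_eq0_fst :
  (forall y, B y -> \int[m1]_(x in A) f (x, y) = 0) ->
  \int[m1 \x m2]_(z in A `*` B) f z = 0.
Proof.
move=> fA0; rewrite integral_mkcond -integral21_prod_meas1//.
apply: integral0_eq => y _; rewrite /fubini_G.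
have [By|nBy] := pselect (B y).
  rewrite -[RHS](fA0 _ By) [RHS]integral_mkcond; apply: eq_integral => x _.
  by rewrite !patchE /= in_setX/= (mem_set By) andbT.
apply: integral0_eq => x _; rewrite patchE memNset//= => -[].
by [].
Qed.

End fubini_eq0.

(** * Bounded measurable functions *)

Section bounded_measurable.
Context {R : realType}.

(** A class stable under the ring operations and contained in the integrable functions on any set of
    finite measure; integrability on the box can thus be read off the shape of a formula. *)
Definition bmeasurable d (T : measurableType d) (f : T -> R) :=
  measurable_fun [set: T] f /\ exists C, forall x, `|f x| <= C.

Section closure.
Context d (T : measurableType d).
Implicit Types f g : T -> R.

Lemma bmeasurable_cst c : bmeasurable (fun _ : T => c).
Proof. by split => //; exists `|c|. Qed.

Lemma bmeasurableD f g : bmeasurable f -> bmeasurable g ->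
  bmeasurable (fun x => f x + g x).
Proof.
move=> [mf [C fC]] [mg [C' gC]]; split; first exact: measurable_funD.
by exists (C + C') => x; rewrite (le_trans (ler_normD _ _))// lerD.
Qed.

Lemma bmeasurableN f : bmeasurable f -> bmeasurable (fun x => - f x).
Proof.
move=> [mf [C fC]]; split; first exact: measurableT_comp.
by exists C => x; rewrite normrN.
Qed.

Lemma bmeasurableM f g : bmeasurable f -> bmeasurable g ->
  bmeasurable (fun x => f x * g x).
Proof.
move=> [mf [C fC]] [mg [C' gC]]; split; first exact: measurable_funM.
by exists (C * C') => x; rewrite normrM ler_pM.
Qed.

Lemma bmeasurableX f n : bmeasurable f -> bmeasurable (fun x => f x ^+ n).
Proof.
move=> bf; elim: n => [|n IH]; first exact: bmeasurable_cst.
by under eq_fun do rewrite exprS; exact: bmeasurableM.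
Qed.

Lemma bmeasurable_sin f : measurable_fun [set: T] f ->
  bmeasurable (fun x => sin (f x)).
Proof.
move=> mf; split; last first.
  by exists 1 => x; rewrite ler_norml sin_geN1 sin_le1.
apply: measurableT_comp mf; apply: continuous_measurable_fun.
exact: continuous_sin.
Qed.

Lemma bmeasurable_cos f : measurable_fun [set: T] f ->
  bmeasurable (fun x => cos (f x)).
Proof.
move=> mf; split; last first.
  by exists 1 => x; rewrite ler_norml cos_geN1 cos_le1.
apply: measurableT_comp mf; apply: continuous_measurable_fun.
exact: continuous_cos.
Qed.

Lemma bmeasurableV f e : 0 < e -> (forall x, e <= f x) -> bmeasurable f ->
  bmeasurable (fun x => (f x)^-1).
Proof.
move=> e0 fe [mf _]; split.
  (* For positive values the inverse is exp(-ln), which reduces its measurability to that of [ln]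
     and [expR]. *)
  rewrite (_ : (fun x => _) = fun x => expR (- ln (f x))).
    by apply: measurableT_comp => //; do 2 apply: measurableT_comp => //.
  by apply/funext => x; rewrite expRN lnK// posrE (lt_le_trans e0).
exists e^-1 => x; have fx0 := lt_le_trans e0 (fe x).
by rewrite ger0_norm ?invr_ge0 ?(ltW fx0)// lef_pV2// posrE.
Qed.

Lemma bmeasurable_ln f e : 0 < e -> (forall x, e <= f x) -> bmeasurable f ->
  bmeasurable (fun x => ln (f x)).
Proof.
move=> e0 fe [mf [C fC]]; split; first exact: measurableT_comp.
(* By monotonicity [ln (f x)] lies between [ln e] and [ln C], whose signs are not known. *)
exists (`|ln e| + `|ln C|) => x; have fx0 := lt_le_trans e0 (fe x).
have fxC : f x <= C by exact: le_trans (ler_norm _) (fC x).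
have C0 := lt_le_trans fx0 fxC.
have := ler_norm (ln C); have := lerNnormlW (lexx `|ln e|).
have : ln e <= ln (f x) by rewrite ler_ln ?posrE.
have : ln (f x) <= ln C by rewrite ler_ln ?posrE.
have := normr_ge0 (ln e); have := normr_ge0 (ln C).
by rewrite ler_norml; lra.
Qed.

Lemma bmeasurable_integrable (mu : {measure set T -> \bar R}) (A : set T) f :
  measurable A -> (mu A < +oo)%E -> bmeasurable f ->
  mu.-integrable A (EFin \o f).
Proof.
move=> mA fA [mf [C fC]]; apply: measurable_bounded_integrable => //.
  exact: measurable_funTS.
exists C; split; first exact: num_real.
by move=> M CM x _; apply: le_trans (fC x) (ltW CM).
Qed.

End closure.

Lemma bmeasurable_comp d d' (T : measurableType d) (T' : measurableType d')
    (f : T' -> R) (h : T -> T') :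
  measurable_fun [set: T] h -> bmeasurable f -> bmeasurable (fun x => f (h x)).
Proof.
move=> mh [mf [C fC]]; split; first exact: measurableT_comp.
by exists C => x; exact: fC.
Qed.

End bounded_measurable.

(** * Divergences on the coordinate box *)

Section box_divergence.
Context {R : realType}.
Notation mu := (@lebesgue_measure R).
Notation Rm := (measurableTypeR R).
Notation R3 := (Rm * Rm * Rm)%type.
Notation box := (sphere_box : set R3).

Lemma integral_derivative_eq0 (F f : R -> R) (a b : R) : a < b ->
  (forall x : R, is_derive x 1 F (f x)) -> continuous f -> F a = F b ->
  (\int[mu]_(x in `[a, b]) (f x)%:E = 0)%E.
Proof.
move=> ab dF cf Fab.
have cF : continuous F.
  move=> x; apply/differentiable_continuous/derivable1_diffP.
  by have [] := dF x.
rewrite (@continuous_FTC2 _ f F)//.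
- by rewrite Fab subee.
- exact: continuous_subspaceT.
- split.
  + by move=> x _; have [] := dF x.
  + exact/cvg_at_right_filter/cF.
  + exact/cvg_at_left_filter/cF.
- by move=> x _; rewrite derive1E; have [_ ->] := dF x.
Qed.

Let pi2_gt0 : 0 < 2 * pi :> R. Proof. by rewrite mulr_gt0// pi_gt0. Qed.

Let itv_fin (a b : R) : (mu `[a, b] < +oo)%E.
Proof. by rewrite lebesgue_measure_itv/=; case: ifPn => // _; rewrite -EFinD ltry. Qed.

Let rectangle_fin (a b c d : R) : ((mu \x mu) (`[a, b] `*` `[c, d]) < +oo)%E.
Proof.
rewrite product_measure1E; [|exact: measurable_itv..].
by apply: lte_mul_pinfty; rewrite ?ge0_fin_numE//; exact: itv_fin.
Qed.

Let lebesgue2_sigma_finite : sigma_finite [set: Rm * Rm] (mu \x mu)%E.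
Proof.
exists (fun n => `[- n%:R, n%:R] `*` `[- n%:R, n%:R]).
  apply/seteqP; split=> // -[x y] _; exists (Num.truncn (`|x| + `|y|)).+1 => //.
  have := truncnS_gt (`|x| + `|y|); set N := _.+1%:R => xyN.
  have := normr_ge0 x; have := normr_ge0 y; have := lexx `|x|.
  have := lexx `|y|; rewrite !ler_norml => /andP[y1 y2] /andP[x1 x2] x0 y0.
  by split; rewrite /= in_itv/=; apply/andP; split; lra.
move=> n; split; last exact: rectangle_fin.
by apply: measurableX; exact: measurable_itv.
Qed.

(** The threefold product is associated to the left, so Fubini takes the product of the first two
    factors as one sigma-finite measure. *)
Let mu2 : {sigma_finite_measure set (Rm * Rm)%type -> \bar R} :=
  HB.pack (mu \x mu)%E (Measure_isSigmaFinite.Build _ _ _ (mu \x mu)%E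
    lebesgue2_sigma_finite).

Lemma sphere_box_lty : (lebesgue3 box < +oo)%E.
Proof.
rewrite [X in (X < _)%E](_ : _ = (mu \x mu) (`[0%R, pi] `*` `[0%R, pi]) *
    mu `[0%R, (2 * pi)%R])%E; last first.
  apply: product_measure1E; last exact: measurable_itv.
  by apply: measurableX; exact: measurable_itv.
by apply: lte_mul_pinfty; rewrite ?ge0_fin_numE//; exact: rectangle_fin.
Qed.

Lemma box_integrable (f : R3 -> R) : bmeasurable f ->
  lebesgue3.-integrable box (EFin \o f).
Proof.
apply: bmeasurable_integrable; first exact: measurable_sphere_box.
exact: sphere_box_lty.
Qed.

Let mpi : measurable (`[0, pi] : set Rm). Proof. exact: measurable_itv. Qed.
Let m2pi : measurable (`[0, 2 * pi] : set Rm). Proof. exact: measurable_itv. Qed.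

(** Fubini puts the last coordinate innermost, where the fundamental theorem of calculus gives zero
    because [F] agrees at the two ends. *)
Lemma box_integral_derivative3 (F f : R3 -> R) : bmeasurable f ->
  (forall a b c : R, is_derive c 1 (fun x => F (a, b, x)) (f (a, b, c))) ->
  (forall a b, continuous (fun x => f (a, b, x))) ->
  (forall a b, F (a, b, 0) = F (a, b, 2 * pi)) ->
  \int[lebesgue3]_(t in box) f t = 0.
Proof.
move=> bf dF cf F0; rewrite /Rintegral [X in fine X](_ : _ = 0%E)//.
apply: (@integral_setX_eq0_snd _ _ _ _ R mu2 mu _ _ (fun t => (f t)%:E)).
- exact: measurableX.
- exact: m2pi.
- exact: box_integrable.
- by case=> a b _; apply: (@integral_derivative_eq0 (fun x => F (a, b, x))).
Qed.

(** Fubini is used twice: [c] is frozen first, then [a] in the remaining double integral. *)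
Lemma box_integral_derivative2 (F f : R3 -> R) : bmeasurable f ->
  (forall a b c : R, is_derive b 1 (fun x => F (a, x, c)) (f (a, b, c))) ->
  (forall a c, continuous (fun x => f (a, x, c))) ->
  (forall a c, F (a, 0, c) = F (a, pi, c)) ->
  \int[lebesgue3]_(t in box) f t = 0.
Proof.
move=> bf dF cf F0; rewrite /Rintegral [X in fine X](_ : _ = 0%E)//.
apply: (@integral_setX_eq0_fst _ _ _ _ R mu2 mu _ _ (fun t => (f t)%:E)).
- exact: measurableX.
- exact: m2pi.
- exact: box_integrable.
move=> c _.
apply: (@integral_setX_eq0_snd _ _ _ _ R mu mu _ _ (fun x => (f (x, c))%:E)) => //.
- apply: bmeasurable_integrable; [exact: measurableX|exact: rectangle_fin|].
  by apply: (bmeasurable_comp (h := fun x => (x, c)) _ bf);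
    exact: measurable_fun_pair.
- move=> a _; apply: (@integral_derivative_eq0 (fun x => F (a, x, c))) => //.
  exact: pi_gt0.
Qed.

Lemma box_integral_derivative1 (F f : R3 -> R) : bmeasurable f ->
  (forall a b c : R, is_derive a 1 (fun x => F (x, b, c)) (f (a, b, c))) ->
  (forall b c, continuous (fun x => f (x, b, c))) ->
  (forall b c, F (0, b, c) = F (pi, b, c)) ->
  \int[lebesgue3]_(t in box) f t = 0.
Proof.
move=> bf dF cf F0; rewrite /Rintegral [X in fine X](_ : _ = 0%E)//.
apply: (@integral_setX_eq0_fst _ _ _ _ R mu2 mu _ _ (fun t => (f t)%:E)).
- exact: measurableX.
- exact: m2pi.
- exact: box_integrable.
move=> c _.
apply: (@integral_setX_eq0_fst _ _ _ _ R mu mu _ _ (fun x => (f (x, c))%:E)) => //.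
- apply: bmeasurable_integrable; [exact: measurableX|exact: rectangle_fin|].
  by apply: (bmeasurable_comp (h := fun x => (x, c)) _ bf);
    exact: measurable_fun_pair.
- move=> b _; apply: (@integral_derivative_eq0 (fun x => F (x, b, c))) => //.
  exact: pi_gt0.
Qed.

(** Differentiation under the integral sign, dominated by a constant on a box of finite volume,
    gives derivative zero; the mean value theorem concludes. *)
Lemma box_integral_constant (U dU : R -> R3 -> R) (u v C : R) :
  (forall x, u < x < v -> bmeasurable (U x)) ->
  (forall (x : R) t, u < x < v -> is_derive x 1 (U^~ t) (dU x t)) ->
  (forall x t, u < x < v -> `|dU x t| <= C) ->
  (forall x, u < x < v -> \int[lebesgue3]_(t in box) dU x t = 0) ->
  forall x y, u < x < v -> u < y < v ->
  \int[lebesgue3]_(t in box) U x t = \int[lebesgue3]_(t in box) U y t.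
Proof.
move=> bU dUE dUC dU0.
pose I x := \int[lebesgue3]_(t in box) U x t.
have iI (x : R) : `]u, v[%classic x = (u < x < v) :> Prop by rewrite /= in_itv.
have d1U x t : u < x < v -> partial1of2 U x t = dU x t.
  by move=> xuv; rewrite /partial1of2 derive1E; have [_ ->] := dUE x t xuv.
(* The dominating function must be nonnegative, hence the absolute value. *)
have C0 : 0 <= `|C| by [].
have iC : lebesgue3.-integrable box (EFin \o (fun _ => `|C|)).
  by apply: box_integrable; exact: bmeasurable_cst.
have dI x : u < x < v -> is_derive x 1 I 0.
  move=> xuv.
  have h1 y : `]u, v[%classic y -> lebesgue3.-integrable box (EFin \o U y).
    by rewrite iI => yuv; apply: box_integrable; exact: bU.
  have h2 y t : `]u, v[%classic y -> box t -> derivable (U^~ t) y 1.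
    by rewrite iI => yuv _; have [] := dUE y t yuv.
  have h3 y t : `]u, v[%classic y -> box t -> `|partial1of2 U y t| <= `|C|.
    rewrite iI => yuv _; rewrite d1U//; apply: le_trans (dUC _ _ yuv) _.
    exact: ler_norm.
  have h4 : `]u, v[%classic x by rewrite iI.
  have mb := @measurable_sphere_box R.
  split.
    exact: (derivable_under_integral mb h4 h1 h2 (fun _ => C0) iC h3).
  rewrite -derive1E.
  apply: etrans
    (differentiation_under_integral mb h4 h1 h2 (fun _ => C0) iC h3) _.
  rewrite -(dU0 _ xuv); apply: eq_Rintegral => t _; exact: d1U.
suff H x y : u < x < v -> u < y < v -> x <= y -> I x = I y.
  move=> x y xuv yuv; have [xy|/ltW yx] := leP x y; first exact: H.
  by apply/esym; exact: H.
move=> xuv yuv xy.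
have sub z : z \in `[x, y] -> u < z < v.
  by rewrite in_itv/= => /andP[xz zy]; apply/andP; split; lra.
have dIxy z : z \in `]x, y[ -> is_derive z 1 I ((fun=> 0) z).
  by move=> /subset_itv_oo_cc /sub /dI.
have cI : {within `[x, y], continuous I}.
  by apply: derivable_within_continuous => z /sub /dI [].
have [_ _ /eqP] := MVT_segment xy dIxy cI.
by rewrite mul0r subr_eq0 => /eqP.
Qed.

End box_divergence.

(** * Derivatives and continuity by the structure of a formula *)

Section pointwise_calculus.
Context {R : realType}.
Implicit Types (f g : R -> R) (x c : R).

(* [is_derive] is a class, which [apply] would instantiate on its own. *)
Definition is_der f x (d : R) := is_derive x 1 f d.

Lemma is_der_eq f x d d' : is_der f x d -> d = d' -> is_derive x 1 f d'.
Proof. by move=> fd <-. Qed.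

Lemma is_der_cst x c : is_der (fun=> c) x 0.
Proof. exact: is_derive_cst. Qed.

Lemma is_der_id x : is_der (fun y : R => y) x 1.
Proof. exact: is_derive_id. Qed.

Lemma is_derD f g x df dg : is_der f x df -> is_der g x dg ->
  is_der (fun y => f y + g y) x (df + dg).
Proof. exact: is_deriveD. Qed.

Lemma is_derN f x df : is_der f x df ->
  is_der (fun y => - f y) x (- df).
Proof. exact: is_deriveN. Qed.

Lemma is_derM f g x df dg : is_der f x df -> is_der g x dg ->
  is_der (fun y => f y * g y) x (f x * dg + g x * df).
Proof. exact: is_deriveM. Qed.

Lemma is_derX f n x df : is_der f x df ->
  is_der (fun y => f y ^+ n) x (n%:R * f x ^+ n.-1 * df).
Proof.
move=> fx; elim: n => [|n IH].
  by apply: (is_der_eq (is_der_cst x 1)); rewrite !mul0r.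
under eq_fun do rewrite exprS.
apply: (is_der_eq (is_derM fx IH)).
by case: n {IH} => [|n] /=; rewrite -?natr1 ?exprS; ring.
Qed.

Lemma is_der_sin f x df : is_der f x df ->
  is_der (fun y => sin (f y)) x (cos (f x) * df).
Proof. by move=> ?; apply: is_derive1_comp. Qed.

Lemma is_der_cos f x df : is_der f x df ->
  is_der (fun y => cos (f y)) x (- sin (f x) * df).
Proof. by move=> ?; apply: is_derive1_comp. Qed.

Lemma is_der_atan f x df : is_der f x df ->
  is_der (fun y => atan (f y)) x ((1 + f x ^+ 2)^-1 * df).
Proof. by move=> ?; apply: is_derive1_comp. Qed.

Lemma is_der_ln f x df : 0 < f x -> is_der f x df ->
  is_der (fun y => ln (f y)) x ((f x)^-1 * df).
Proof. by move=> /is_derive1_ln ? ?; apply: is_derive1_comp. Qed.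

Lemma is_derV f x df : f x != 0 -> is_der f x df ->
  is_der (fun y => (f y)^-1) x (- (f x) ^- 2 * df).
Proof. exact: is_deriveV. Qed.

Lemma cts_cst c : continuous (fun _ : R => c).
Proof. by move=> x; exact: cvg_cst. Qed.

Lemma cts_id : continuous (fun y : R => y).
Proof. by move=> x; exact: cvg_id. Qed.

Lemma ctsD f g : continuous f -> continuous g -> continuous (fun y => f y + g y).
Proof. by move=> cf cg x; exact: (cvgD (cf x) (cg x)). Qed.

Lemma ctsN f : continuous f -> continuous (fun y => - f y).
Proof. by move=> cf x; exact: (cvgN (cf x)). Qed.

Lemma ctsM f g : continuous f -> continuous g -> continuous (fun y => f y * g y).
Proof. by move=> cf cg x; exact: (cvgM (cf x) (cg x)). Qed.

Lemma ctsX f n : continuous f -> continuous (fun y => f y ^+ n).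
Proof.
move=> cf; elim: n => [|n IH]; first exact: cts_cst.
by under eq_fun do rewrite exprS; exact: ctsM.
Qed.

Lemma ctsV f : (forall x, f x != 0) -> continuous f ->
  continuous (fun y => (f y)^-1).
Proof. by move=> f0 cf x; exact: (cvgV (f0 x) (cf x)). Qed.

Lemma cts_ln f : (forall x, 0 < f x) -> continuous f ->
  continuous (fun y => ln (f y)).
Proof. by move=> f0 cf x; exact: (continuous_comp (cf x) (continuous_ln (f0 x))). Qed.

Lemma cts_sin : continuous (fun y : R => sin y).
Proof. exact: continuous_sin. Qed.

Lemma cts_cos : continuous (fun y : R => cos y).
Proof. exact: continuous_cos. Qed.

End pointwise_calculus.

(** The derivative is synthesized along the formula, constants being tried first; [is_der_eq] leaves
    its comparison with the expected value to [ring] or [field]. *)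
Ltac derive_step := first
  [ exact: is_der_cst | exact: is_der_id | apply: is_derD | apply: is_derN
  | apply: is_derX | apply: is_derM | apply: is_der_sin | apply: is_der_cos ].

(** Matching on the syntax keeps unification from inventing a decomposition. The constant case under
    [sin] and [cos] catches arguments free of the variable. *)
Ltac cts_step := lazymatch goal with
  | |- continuous (fun x => (@?f x + @?g x)%R) => apply: (@ctsD _ f g)
  | |- continuous (fun x => (@?f x * @?g x)%R) => apply: (@ctsM _ f g)
  | |- continuous (fun x => (- @?f x)%R) => apply: (@ctsN _ f)
  | |- continuous (fun x => (@?f x ^+ ?n)%R) => apply: (@ctsX _ f n)
  | |- continuous (fun x => sin (@?f x)) => first [exact: cts_cst | exact: cts_sin]
  | |- continuous (fun x => cos (@?f x)) => first [exact: cts_cst | exact: cts_cos]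
  | |- _ => first [exact: cts_cst | exact: cts_id]
  end.

Ltac bmeasurable_step := first
  [ exact: bmeasurable_cst | apply: bmeasurableD | apply: bmeasurableN
  | apply: bmeasurableX | apply: bmeasurableM
  | apply: bmeasurable_sin; by [|exact: measurableT_comp]
  | apply: bmeasurable_cos; by [|exact: measurableT_comp] ].

(** * The logarithmic kernel *)

Section kernel.
Context {R : realType}.
Notation H := (quaternion R).
Notation Rm := (measurableTypeR R).
Notation R3 := (Rm * Rm * Rm)%type.
Notation box := (sphere_box : set R3).
Implicit Types (q : H) (n : R).

Definition sphere_dot q (t : R3) : R :=
  qt q * cos t.1.1 + sin t.1.1 * (qx q * cos t.1.2 +
    sin t.1.2 * (qy q * cos t.2 + qz q * sin t.2)).

(** The area density of the unit sphere on the box, where [sin t.1.2] is nonnegative; without an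
    absolute value it is smooth everywhere. *)
Definition sphere_weight (t : R3) : R := sin t.1.1 ^+ 2 * sin t.1.2.

(** For [n = qnorm q] this is |w - q|^2, with w the unit vector of angles [t]. A separate [n] stays
    fixed while the pole moves. *)
Definition sphere_kernel n q (t : R3) : R := 1 + n ^+ 2 - 2 * sphere_dot q t.

Definition log_potential n q : R :=
  \int[lebesgue3]_(t in box) (ln (sphere_kernel n q t) * sphere_weight t).

Lemma sphere_dotE q t : sphere_dot q t = qdot (sphere_param 1 t) q.
Proof.
case: t => [[a b] c].
by rewrite /sphere_dot /qdot /quat /qt /qx /qy /qz /=; ring.
Qed.

Lemma sphere_dot_le q t : `|sphere_dot q t| <= qnorm q.
Proof.
have qq0 (u : H) : 0 <= qdot u u by rewrite /qdot -!expr2 !addr_ge0// sqr_ge0.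
have p1 : qdot (sphere_param 1 t) (sphere_param 1 t) = 1.
  have := @qnorm_sphere_param R 1 t ler01; rewrite /qnorm => p1.
  by have := sqr_sqrtr (qq0 (sphere_param 1 t)); rewrite p1 expr1n.
rewrite sphere_dotE /qnorm; move: (sphere_param 1 t) p1 => p p1.
rewrite -sqrtr_sqr ler_sqrt// -[leRHS]mul1r -p1 -subr_ge0.
(* Lagrange's identity: the defect in the Cauchy-Schwarz inequality is the sum of the squared 2 x 2
   minors. *)
rewrite (_ : _ - _ = (qt p * qx q - qx p * qt q) ^+ 2 +
  (qt p * qy q - qy p * qt q) ^+ 2 + (qt p * qz q - qz p * qt q) ^+ 2 +
  (qx p * qy q - qy p * qx q) ^+ 2 + (qx p * qz q - qz p * qx q) ^+ 2 +
  (qy p * qz q - qz p * qy q) ^+ 2); last by rewrite /qdot; ring.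
by rewrite !addr_ge0// sqr_ge0.
Qed.

Lemma sphere_weight_le1 t : `|sphere_weight t| <= 1.
Proof.
have sin1 (x : R) : `|sin x| <= 1 by rewrite ler_norml sin_geN1 sin_le1.
by rewrite /sphere_weight normrM normrX mulr_ile1 ?exprn_ile1 ?exprn_ge0.
Qed.

Lemma bmeasurable_sphere_dot q : bmeasurable (sphere_dot q).
Proof. by rewrite /sphere_dot; repeat bmeasurable_step. Qed.

Lemma bmeasurable_sphere_weight : bmeasurable sphere_weight.
Proof. by rewrite /sphere_weight; repeat bmeasurable_step. Qed.

Lemma cts_sphere_dot1 q (b c : R) : continuous (fun x : R => sphere_dot q (x, b, c)).
Proof. by rewrite /sphere_dot /=; repeat cts_step. Qed.

Lemma cts_sphere_dot2 q (a c : R) : continuous (fun x : R => sphere_dot q (a, x, c)).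
Proof. by rewrite /sphere_dot /=; repeat cts_step. Qed.

Lemma cts_sphere_dot3 q (a b : R) : continuous (fun x : R => sphere_dot q (a, b, x)).
Proof. by rewrite /sphere_dot /=; repeat cts_step. Qed.

Section fixed_norm.
Variables (n : R) (n1 : n < 1).

Lemma sphere_kernel_ge q t : qnorm q <= n -> (1 - n) ^+ 2 <= sphere_kernel n q t.
Proof.
move=> qn; have := le_trans (sphere_dot_le q t) qn.
by rewrite ler_norml /sphere_kernel => /andP[_]; nra.
Qed.

Lemma sqr_gap_gt0 : 0 < (1 - n) ^+ 2.
Proof. by rewrite exprn_gt0// subr_gt0. Qed.

Lemma sphere_kernel_gt0 q t : qnorm q <= n -> 0 < sphere_kernel n q t.
Proof. by move=> qn; exact: lt_le_trans sqr_gap_gt0 (sphere_kernel_ge t qn). Qed.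

Section fixed_pole.
Variables (q : H) (qn : qnorm q <= n).

Lemma bmeasurable_sphere_kernel : bmeasurable (sphere_kernel n q).
Proof.
by rewrite /sphere_kernel;
  repeat first [exact: bmeasurable_sphere_dot | bmeasurable_step].
Qed.

Lemma bmeasurable_ln_sphere_kernel :
  bmeasurable (fun t => ln (sphere_kernel n q t)).
Proof.
apply: (bmeasurable_ln sqr_gap_gt0); last exact: bmeasurable_sphere_kernel.
by move=> t; exact: sphere_kernel_ge.
Qed.

Lemma bmeasurable_sphere_kernelV :
  bmeasurable (fun t => (sphere_kernel n q t)^-1).
Proof.
apply: (bmeasurableV sqr_gap_gt0); last exact: bmeasurable_sphere_kernel.
by move=> t; exact: sphere_kernel_ge.
Qed.

Lemma cts_sphere_kernel (g : R -> R3) : continuous (sphere_dot q \o g) ->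
  [/\ continuous (fun x : R => sphere_kernel n q (g x)),
      continuous (fun x : R => ln (sphere_kernel n q (g x))) &
      continuous (fun x : R => (sphere_kernel n q (g x))^-1)].
Proof.
move=> cg; have cE : continuous (fun x : R => sphere_kernel n q (g x)).
  by rewrite /sphere_kernel; repeat first [exact: cg | cts_step].
split=> //; first by apply: cts_ln => // x; exact: sphere_kernel_gt0.
by apply: ctsV => // x; rewrite gt_eqF// sphere_kernel_gt0.
Qed.

Lemma is_der_sphere_kernel (g : R -> R3) (x d : R) :
  is_der (fun y => sphere_dot q (g y)) x d ->
  is_der (fun y => ln (sphere_kernel n q (g y))) x
    ((sphere_kernel n q (g x))^-1 * (- (2 * d))).
Proof.
move=> gd; apply: is_der_ln; first exact: sphere_kernel_gt0.
rewrite /sphere_kernel; apply: is_der_eq.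
  by repeat first [exact: gd | derive_step].
by ring.
Qed.

Lemma is_der_sphere_dot1 (a b c : R) :
  is_der (fun x => sphere_dot q (x, b, c)) a
    (- (qt q * sin a) + cos a * (qx q * cos b +
       sin b * (qy q * cos c + qz q * sin c))).
Proof.
by rewrite /sphere_dot/=; apply: is_der_eq; [repeat derive_step|rewrite /=; ring].
Qed.

Lemma is_der_sphere_dot2 (a b c : R) :
  is_der (fun x => sphere_dot q (a, x, c)) b
    (sin a * (- (qx q * sin b) + cos b * (qy q * cos c + qz q * sin c))).
Proof.
by rewrite /sphere_dot/=; apply: is_der_eq; [repeat derive_step|rewrite /=; ring].
Qed.

Lemma is_der_sphere_dot3 (a b c : R) :
  is_der (fun x => sphere_dot q (a, b, x)) c
    (sin a * sin b * (- (qy q * sin c) + qz q * cos c)).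
Proof.
by rewrite /sphere_dot/=; apply: is_der_eq; [repeat derive_step|rewrite /=; ring].
Qed.

End fixed_pole.
End fixed_norm.
End kernel.

(** * Invariance of the potential under rotations of the pole *)

Section rotations.
Context {R : realType}.
Notation H := (quaternion R).
Notation Rm := (measurableTypeR R).
Notation R3 := (Rm * Rm * Rm)%type.
Notation box := (sphere_box : set R3).
Variables (n : R) (n1 : n < 1).

Lemma bmeasurable_log_potential_slope (p d : H) : qnorm p <= n ->
  bmeasurable (fun t => sphere_dot d t / sphere_kernel n p t * sphere_weight t).
Proof.
move=> pn; apply: bmeasurableM; last exact: bmeasurable_sphere_weight.
apply: bmeasurableM; first exact: bmeasurable_sphere_dot.
exact: bmeasurable_sphere_kernelV.
Qed.

Lemma log_potential_constant (p dp : R -> H) :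
  (forall x, qnorm (p x) <= n) -> (forall x, qnorm (dp x) <= n) ->
  (forall x t, is_der (fun y => sphere_dot (p y) t) x (sphere_dot (dp x) t)) ->
  (forall x, \int[lebesgue3]_(t in box)
    (sphere_dot (dp x) t / sphere_kernel n (p x) t * sphere_weight t) = 0) ->
  forall x y, log_potential n (p x) = log_potential n (p y).
Proof.
move=> pn dpn pdp int0 x y; pose m := `|x| + `|y| + 1.
(* The interval ]-m, m[ contains [x] and [y]. The bound combines |<w, dp>| <= n, the lower bound (1
   - n)^2 of the kernel, and a weight of modulus at most 1. *)
apply: (@box_integral_constant _
  (fun x t => ln (sphere_kernel n (p x) t) * sphere_weight t)
  (fun x t => - 2 * (sphere_dot (dp x) t / sphere_kernel n (p x) t *
    sphere_weight t)) (- m) m (2 * (n * ((1 - n) ^+ 2)^-1))).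
- move=> z _; apply: bmeasurableM; last exact: bmeasurable_sphere_weight.
  exact: bmeasurable_ln_sphere_kernel.
- move=> z t _; apply: is_der_eq.
    apply: is_derM; last exact: is_der_cst.
    apply: is_der_ln; first exact: sphere_kernel_gt0.
    by rewrite /sphere_kernel; repeat first [exact: pdp|derive_step].
  by rewrite /=; ring.
- move=> z t _; rewrite normrM normrN normr_nat ler_pM2l//.
  have E0 := sphere_kernel_gt0 n1 t (pn z).
  rewrite -[leRHS]mulr1 normrM ler_pM ?sphere_weight_le1//.
  rewrite normrM ler_pM//; first exact: le_trans (sphere_dot_le _ _) (dpn z).
  rewrite normfV (gtr0_norm E0) lef_pV2 ?posrE ?sqr_gap_gt0//.
  exact: sphere_kernel_ge.
- move=> z _; rewrite RintegralZl ?int0 ?mulr0//.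
    exact: measurable_sphere_box.
  by apply: box_integrable; exact: bmeasurable_log_potential_slope.
- by rewrite /m; have := ler_norm x; have := ler_norm (- x); rewrite normrN;
    have := normr_ge0 y; lra.
- by rewrite /m; have := ler_norm y; have := ler_norm (- y); rewrite normrN;
    have := normr_ge0 x; lra.
Qed.

Let sqr_trig (w x : R) : (w * cos x) ^+ 2 + (w * sin x) ^+ 2 = w ^+ 2.
Proof. by rewrite !exprMn -mulrDr cos2Dsin2 mulr1. Qed.

Lemma qnorm_le (q : H) : 0 <= n ->
  qt q ^+ 2 + qx q ^+ 2 + qy q ^+ 2 + qz q ^+ 2 <= n ^+ 2 -> qnorm q <= n.
Proof.
by move=> n0 qn; rewrite /qnorm -(ger0_norm n0) -sqrtr_sqr ler_sqrt ?sqr_ge0.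
Qed.

(** Turning the pole in this plane amounts to shifting the angle [c]. The slope is therefore the
    [c]-derivative of half the weighted logarithm, which is periodic in [c]. *)
Lemma log_potential_rotation_yz (t x w phi : R) :
  0 <= n -> t ^+ 2 + x ^+ 2 + w ^+ 2 <= n ^+ 2 ->
  log_potential n (quat t x (w * cos phi) (w * sin phi)) =
  log_potential n (quat t x w 0).
Proof.
move=> n0 twn.
have pn y : qnorm (quat t x (w * cos y) (w * sin y)) <= n.
  apply: qnorm_le => //; rewrite /quat /qt /qx /qy /qz /=.
  by have := sqr_trig w y; nra.
have -> : quat t x w 0 = quat t x (w * cos 0) (w * sin 0).
  by rewrite cos0 sin0 mulr1 mulr0.
apply: (@log_potential_constant
  (fun y => quat t x (w * cos y) (w * sin y))
  (fun y => quat 0 0 (- (w * sin y)) (w * cos y))).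
- exact: pn.
- move=> y; apply: qnorm_le => //; rewrite /quat /qt /qx /qy /qz /=.
  by have := sqr_trig w y; nra.
- move=> y s; rewrite /sphere_dot /quat /qt /qx /qy /qz /=.
  by apply: is_der_eq; [repeat derive_step|rewrite /=; ring].
- move=> y; set q := quat t x _ _.
  have qn : qnorm q <= n by exact: pn.
  apply: (@box_integral_derivative3 _
    (fun s => 2^-1 * (ln (sphere_kernel n q s) * sphere_weight s))).
  + exact: bmeasurable_log_potential_slope.
  + move=> a b c; rewrite /sphere_weight/=; apply: is_der_eq.
      repeat first [apply: is_der_sphere_kernel (is_der_sphere_dot3 _ _ _ _)
                   |derive_step]; by [].
    move: (sphere_kernel _ _ _) (sphere_kernel_gt0 n1 (a, b, c) qn) => E E0.
    rewrite /q /sphere_dot /quat /qt /qx /qy /qz /=.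
    by field; exact: lt0r_neq0.
  + move=> a b.
    have [_ _ cE] := cts_sphere_kernel n1 qn (@cts_sphere_dot3 _ q a b).
    apply: ctsM; last by rewrite /sphere_weight/=; repeat cts_step.
    by apply: ctsM cE; exact: cts_sphere_dot3.
  + move=> a b; rewrite /sphere_kernel /sphere_dot /=.
    by rewrite (_ : 2 * pi = pi *+ 2) ?mulr_natl// cos2pi sin2pi cos0 sin0.
Qed.

(** The rotation field times [sphere_weight] is divergence-free in the coordinates, so the slope is
    the divergence of half the logarithm times this field. *)
Lemma log_potential_rotation_xy (t w phi : R) :
  0 <= n -> t ^+ 2 + w ^+ 2 <= n ^+ 2 ->
  log_potential n (quat t (w * cos phi) (w * sin phi) 0) =
  log_potential n (quat t w 0 0).
Proof.
move=> n0 twn.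
have pn y : qnorm (quat t (w * cos y) (w * sin y) 0) <= n.
  apply: qnorm_le => //; rewrite /quat /qt /qx /qy /qz /=.
  by have := sqr_trig w y; nra.
have -> : quat t w 0 0 = quat t (w * cos 0) (w * sin 0) 0.
  by rewrite cos0 sin0 mulr1 mulr0.
apply: (@log_potential_constant
  (fun y => quat t (w * cos y) (w * sin y) 0)
  (fun y => quat 0 (- (w * sin y)) (w * cos y) 0)).
- exact: pn.
- move=> y; apply: qnorm_le => //; rewrite /quat /qt /qx /qy /qz /=.
  by have := sqr_trig w y; nra.
- move=> y s; rewrite /sphere_dot /quat /qt /qx /qy /qz /=.
  by apply: is_der_eq; [repeat derive_step|rewrite /=; ring].
- move=> y; set q := quat t _ _ _.
  have qn : qnorm q <= n by exact: pn.
  (* the field generating the rotation of the (x, y) plane has coordinates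
     [cos c] along [b] and [- cos b * sin c / sin b] along [c] *)
  pose L s := ln (sphere_kernel n q s).
  pose V s := (sphere_kernel n q s)^-1.
  (* The weight cancels the denominator [sin b] of the field. [F2] vanishes at both ends of the
     range of [b], and [F3] is periodic in [c]. *)
  pose F2 (s : R3) := 2^-1 * (cos s.2 * sin s.1.1 ^+ 2) * (sin s.1.2 * L s).
  pose F3 (s : R3) := - 2^-1 * (cos s.1.2 * sin s.1.1 ^+ 2) * (sin s.2 * L s).
  pose f2 (s : R3) := 2^-1 * (cos s.2 * sin s.1.1 ^+ 2) *
    (cos s.1.2 * L s + sin s.1.2 * (V s * (- (2 * (sin s.1.1 *
      (- (qx q * sin s.1.2) + cos s.1.2 * (qy q * cos s.2 + qz q * sin s.2))))))).
  pose f3 (s : R3) := - 2^-1 * (cos s.1.2 * sin s.1.1 ^+ 2) *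
    (cos s.2 * L s + sin s.2 * (V s * (- (2 * (sin s.1.1 * sin s.1.2 *
      (- (qy q * sin s.2) + qz q * cos s.2)))))).
  have bL := bmeasurable_ln_sphere_kernel n1 qn.
  have bV := bmeasurable_sphere_kernelV n1 qn.
  have bf2 : bmeasurable f2.
    by rewrite /f2; repeat first [exact: bL|exact: bV|bmeasurable_step].
  have bf3 : bmeasurable f3.
    by rewrite /f3; repeat first [exact: bL|exact: bV|bmeasurable_step].
  have int2 : \int[lebesgue3]_(s in box) f2 s = 0.
    apply: (@box_integral_derivative2 _ F2) => //.
    - move=> a b c; rewrite /F2/f2/L/=; apply: is_der_eq.
        by repeat first [apply: is_der_sphere_kernel (is_der_sphere_dot2 _ _ _ _)
                        |derive_step].
      by rewrite /V/=; ring.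
    - move=> a c; rewrite /f2/L/V/=.
      have [_ cL cV] := cts_sphere_kernel n1 qn (@cts_sphere_dot2 _ q a c).
      by repeat first [exact: cL|exact: cV|cts_step].
    - by move=> a c; rewrite /F2/= sinpi sin0 !mul0r.
  have int3 : \int[lebesgue3]_(s in box) f3 s = 0.
    apply: (@box_integral_derivative3 _ F3) => //.
    - move=> a b c; rewrite /F3/f3/L/=; apply: is_der_eq.
        by repeat first [apply: is_der_sphere_kernel (is_der_sphere_dot3 _ _ _ _)
                        |derive_step].
      by rewrite /V/=; ring.
    - move=> a b; rewrite /f3/L/V/=.
      have [_ cL cV] := cts_sphere_kernel n1 qn (@cts_sphere_dot3 _ q a b).
      by repeat first [exact: cL|exact: cV|cts_step].
    - move=> a b; rewrite /F3/L/sphere_kernel /sphere_dot /=.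
      by rewrite (_ : 2 * pi = pi *+ 2) ?mulr_natl// cos2pi sin2pi cos0 sin0.
  transitivity (\int[lebesgue3]_(s in box) (f2 s + f3 s)); last first.
    rewrite RintegralD ?int2 ?int3 ?addr0//; last 2 first.
    - exact: box_integrable.
    - exact: box_integrable.
    exact: measurable_sphere_box.
  (* In the sum the terms containing the logarithm itself cancel, and what remains is the slope. *)
  apply: eq_Rintegral => -[[a b] c] _; rewrite /f2 /f3 /L /V.
  move: (sphere_kernel _ _ _) (sphere_kernel_gt0 n1 (a, b, c) qn) => E E0.
  rewrite /sphere_weight /q /sphere_dot /quat /qt /qx /qy /qz /=.
  have c2 : cos c ^+ 2 = 1 - sin c ^+ 2 by rewrite -(cos2Dsin2 c) addrK.
  by field: c2; exact: lt0r_neq0.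
Qed.

Lemma log_potential_rotation_tx (w phi : R) :
  0 <= n -> w ^+ 2 <= n ^+ 2 ->
  log_potential n (quat (w * cos phi) (w * sin phi) 0 0) =
  log_potential n (quat w 0 0 0).
Proof.
move=> n0 twn.
have pn y : qnorm (quat (w * cos y) (w * sin y) 0 0) <= n.
  apply: qnorm_le => //; rewrite /quat /qt /qx /qy /qz /=.
  by have := sqr_trig w y; nra.
have -> : quat w 0 0 0 = quat (w * cos 0) (w * sin 0) 0 0.
  by rewrite cos0 sin0 mulr1 mulr0.
apply: (@log_potential_constant
  (fun y => quat (w * cos y) (w * sin y) 0 0)
  (fun y => quat (- (w * sin y)) (w * cos y) 0 0)).
- exact: pn.
- move=> y; apply: qnorm_le => //; rewrite /quat /qt /qx /qy /qz /=.
  by have := sqr_trig w y; nra.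
- move=> y s; rewrite /sphere_dot /quat /qt /qx /qy /qz /=.
  by apply: is_der_eq; [repeat derive_step|rewrite /=; ring].
- move=> y; set q := quat (w * cos y) (w * sin y) 0 0.
  have qn : qnorm q <= n by exact: pn.
  (* likewise, [cos b] along [a] and [- cos a * sin b / sin a] along [b] *)
  pose L s := ln (sphere_kernel n q s).
  pose V s := (sphere_kernel n q s)^-1.
  (* Here the weight absorbs the denominator [sin a]; the squared sines make [F1] vanish at the ends
     for [a] and [F2] at the ends for [b]. *)
  pose F1 (s : R3) := 2^-1 * (cos s.1.2 * sin s.1.2) * (sin s.1.1 ^+ 2 * L s).
  pose F2 (s : R3) := - 2^-1 * (cos s.1.1 * sin s.1.1) * (sin s.1.2 ^+ 2 * L s).
  pose f1 (s : R3) := 2^-1 * (cos s.1.2 * sin s.1.2) *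
    (2 * sin s.1.1 * cos s.1.1 * L s + sin s.1.1 ^+ 2 * (V s *
      (- (2 * (- (qt q * sin s.1.1) + cos s.1.1 * (qx q * cos s.1.2 +
       sin s.1.2 * (qy q * cos s.2 + qz q * sin s.2))))))).
  pose f2 (s : R3) := - 2^-1 * (cos s.1.1 * sin s.1.1) *
    (2 * sin s.1.2 * cos s.1.2 * L s + sin s.1.2 ^+ 2 * (V s *
      (- (2 * (sin s.1.1 * (- (qx q * sin s.1.2) + cos s.1.2 *
       (qy q * cos s.2 + qz q * sin s.2))))))).
  have bL := bmeasurable_ln_sphere_kernel n1 qn.
  have bV := bmeasurable_sphere_kernelV n1 qn.
  have bf1 : bmeasurable f1.
    by rewrite /f1; repeat first [exact: bL|exact: bV|bmeasurable_step].
  have bf2 : bmeasurable f2.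
    by rewrite /f2; repeat first [exact: bL|exact: bV|bmeasurable_step].
  have int1 : \int[lebesgue3]_(s in box) f1 s = 0.
    apply: (@box_integral_derivative1 _ F1) => //.
    - move=> a b c; rewrite /F1/f1/L/=; apply: is_der_eq.
        by repeat first [apply: is_der_sphere_kernel (is_der_sphere_dot1 _ _ _ _)
                        |derive_step].
      by rewrite /V/=; ring.
    - move=> b c; rewrite /f1/L/V/=.
      have [_ cL cV] := cts_sphere_kernel n1 qn (@cts_sphere_dot1 _ q b c).
      by repeat first [exact: cL|exact: cV|cts_step].
    - by move=> b c; rewrite /F1/= sinpi sin0 expr0n !mul0r.
  have int2 : \int[lebesgue3]_(s in box) f2 s = 0.
    apply: (@box_integral_derivative2 _ F2) => //.
    - move=> a b c; rewrite /F2/f2/L/=; apply: is_der_eq.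
        by repeat first [apply: is_der_sphere_kernel (is_der_sphere_dot2 _ _ _ _)
                        |derive_step].
      by rewrite /V/=; ring.
    - move=> a c; rewrite /f2/L/V/=.
      have [_ cL cV] := cts_sphere_kernel n1 qn (@cts_sphere_dot2 _ q a c).
      by repeat first [exact: cL|exact: cV|cts_step].
    - by move=> a c; rewrite /F2/= sinpi sin0 expr0n !mul0r.
  transitivity (\int[lebesgue3]_(s in box) (f1 s + f2 s)); last first.
    rewrite RintegralD ?int1 ?int2 ?addr0//; last 2 first.
    - exact: box_integrable.
    - exact: box_integrable.
    exact: measurable_sphere_box.
  apply: eq_Rintegral => -[[a b] c] _; rewrite /f1 /f2 /L /V.
  move: (sphere_kernel _ _ _) (sphere_kernel_gt0 n1 (a, b, c) qn) => E E0.
  rewrite /sphere_weight /q /sphere_dot /quat /qt /qx /qy /qz /=.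
  have b2 : cos b ^+ 2 = 1 - sin b ^+ 2 by rewrite -(cos2Dsin2 b) addrK.
  by field: b2; exact: lt0r_neq0.
Qed.

End rotations.

(** * Displacement of the pole along the real axis *)

Section scaling.
Context {R : realType}.
Notation H := (quaternion R).
Notation Rm := (measurableTypeR R).
Notation R3 := (Rm * Rm * Rm)%type.
Notation box := (sphere_box : set R3).

(** This is |1 - s e^{ia}|^2, the kernel for the pole [s] on the real axis. *)
Definition poisson_denom (s a : R) := 1 + s ^+ 2 - 2 * s * cos a.

Lemma poisson_denom_ge (m s a : R) : m < 1 -> `|s| <= m ->
  (1 - m) ^+ 2 <= poisson_denom s a.
Proof.
move=> m1 sm; have sa : s * cos a <= `|s|.
  apply: le_trans (ler_norm _) _; rewrite normrM -[leRHS]mulr1 ler_wpM2l//.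
  by rewrite ler_norml cos_geN1 cos_le1.
have s0 := normr_ge0 s; rewrite /poisson_denom -(real_normK (num_real s)); nra.
Qed.

Lemma poisson_denom_gt0 (s a : R) : `|s| < 1 -> 0 < poisson_denom s a.
Proof.
move=> s1; apply: lt_le_trans (poisson_denom_ge a s1 (lexx _)).
by rewrite exprn_gt0// subr_gt0.
Qed.

Let den_gt0 (s a : R) : `|s| < 1 -> 0 < 1 - s * cos a.
Proof.
move=> s1; rewrite subr_gt0; apply: le_lt_trans (ler_norm _) _.
rewrite normrM; apply: le_lt_trans s1.
rewrite -[leRHS]mulr1 ler_wpM2l//.
by rewrite ler_norml cos_geN1 cos_le1.
Qed.

Let den_neq0 (s a : R) : `|s| < 1 -> 1 - s * cos a != 0.
Proof. by move=> /den_gt0 ?; exact: lt0r_neq0. Qed.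

(** The arctangent is minus the argument of 1 - s e^{ia}, whose real part is positive for |s| <
    1. *)
Lemma is_der_atan_poisson (s a : R) : `|s| < 1 ->
  is_der (fun x => atan (s * sin x * (1 - s * cos x)^-1)) a
    ((s * cos a - s ^+ 2) / poisson_denom s a).
Proof.
move=> s1; apply: is_der_eq.
  apply: is_der_atan; apply: is_derM; first by repeat derive_step.
  by apply: is_derV; [exact: den_neq0|repeat derive_step].
have d0 := den_neq0 a s1.
have c2 : sin a ^+ 2 = 1 - cos a ^+ 2 by rewrite -(cos2Dsin2 a); ring.
(* One plus the squared tangent of the argument is the squared modulus over the squared real
   part. *)
rewrite /= (_ : 1 + _ ^+ 2 = poisson_denom s a / (1 - s * cos a) ^+ 2).
  have := poisson_denom_gt0 a s1; rewrite /poisson_denom => /lt0r_neq0 k0.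
  by field: c2; rewrite ?d0 ?k0.
by rewrite /poisson_denom; field: c2.
Qed.

Let slope (s : R) (t : R3) : R :=
  ((2 * s - 2 * cos t.1.1) / poisson_denom s t.1.1 - s) * sphere_weight t.

(** With D the Poisson denominator, 2s - 2 cos a = (D - (1 - s^2)) / s, so the first factor of
    [slope] is (1 - s^2)(1 - 1/D) / s. This explains the common factor; integrating sin^2 a / D
    brings in the arctangent. *)
Let prim (s : R) (t : R3) : R := (1 - s ^+ 2) *
  (- (2 * s)^-1 * (sin t.1.1 * cos t.1.1) +
   (1 - s ^+ 2) / (2 * s ^+ 3) *
     atan (s * sin t.1.1 * (1 - s * cos t.1.1)^-1)
   - (2 * s ^+ 2)^-1 * sin t.1.1) * sin t.1.2.

Let is_der_prim (s a b c : R) : s != 0 -> `|s| < 1 ->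
  is_derive a 1 (fun x => prim s (x, b, c)) (slope s (a, b, c)).
Proof.
move=> s0 s1; rewrite /prim /slope /sphere_weight/=; apply: is_der_eq.
  by repeat first [exact: is_der_atan_poisson|derive_step].
have c2 : sin a ^+ 2 = 1 - cos a ^+ 2 by rewrite -(cos2Dsin2 a); ring.
have := poisson_denom_gt0 a s1; rewrite /poisson_denom /= => /lt0r_neq0 k0.
by field: c2; rewrite ?s0 ?k0.
Qed.

Let bslope (s : R) : `|s| < 1 -> bmeasurable (slope s).
Proof.
move=> s1; rewrite /slope; apply: bmeasurableM.
  apply: bmeasurableD; last exact: bmeasurable_cst.
  apply: bmeasurableM; first by repeat bmeasurable_step.
  apply: (@bmeasurableV _ _ _ _ ((1 - `|s|) ^+ 2)).
  - by rewrite exprn_gt0// subr_gt0.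
  - by move=> t; exact: poisson_denom_ge.
  - by rewrite /poisson_denom; repeat bmeasurable_step.
exact: bmeasurable_sphere_weight.
Qed.

Let int_slope (s : R) : `|s| < 1 -> \int[lebesgue3]_(t in box) slope s t = 0.
Proof.
move=> s1; have cslope b c : continuous (fun x : R => slope s (x, b, c)).
  rewrite /slope /sphere_weight /=.
  have cV : continuous (fun x : R => (poisson_denom s x)^-1).
    apply: ctsV; first by move=> x; exact/lt0r_neq0/poisson_denom_gt0.
    by rewrite /poisson_denom; repeat cts_step.
  by repeat first [exact: cV|cts_step].
have [s0|s0] := eqVneq s 0; last first.
  apply: (@box_integral_derivative1 _ (prim s)); [exact: bslope| |exact: cslope|].
  - by move=> a b c; exact: is_der_prim.
  - by move=> b c; rewrite /prim/= sinpi sin0 !(mul0r, mulr0) atan0.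
(* At s = 0 the denominators of [prim] vanish; the slope there is -2 cos a sin^2 a sin b, with an
   elementary primitive. *)
apply: (@box_integral_derivative1 _
  (fun t => - (2 / 3) * sin t.1.1 ^+ 3 * sin t.1.2));
  [exact: bslope| |exact: cslope|].
- move=> a b c; rewrite s0 /slope /sphere_weight /poisson_denom/=.
  apply: is_der_eq; first by repeat derive_step.
  by rewrite /=; field.
- by move=> b c; rewrite /= sinpi sin0.
Qed.

Lemma log_potential_axis (s : R) : 0 <= s < 1 ->
  log_potential s (quat s 0 0 0) =
  s ^+ 2 / 2 * \int[lebesgue3]_(t in box) sphere_weight t.
Proof.
(* The midpoint of [s] and 1: ]-m, m[ contains 0 and [s], and the Poisson denominator stays above (1
   - m)^2 on it. *)
move=> /andP[s0 s1]; pose m := (1 + s) / 2.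
have m1 : m < 1 by rewrite /m; lra.
have sm : s < m by rewrite /m; lra.
have m0 : 0 < m by exact: le_lt_trans sm.
pose U (x : R) (t : R3) : R :=
  (ln (poisson_denom x t.1.1) - x ^+ 2 / 2) * sphere_weight t.
have nm x : - m < x < m -> `|x| < m by rewrite ltr_norml.
have bln x : - m < x < m ->
    bmeasurable (fun t : R3 => ln (poisson_denom x t.1.1)).
  move=> /nm xm; apply: (@bmeasurable_ln _ _ _ _ ((1 - m) ^+ 2)).
  - by rewrite exprn_gt0// subr_gt0.
  - by move=> t; apply: poisson_denom_ge => //; exact: ltW.
  - by rewrite /poisson_denom; repeat bmeasurable_step.
have bU x : - m < x < m -> bmeasurable (U x).
  move=> xm; apply: bmeasurableM; last exact: bmeasurable_sphere_weight.
  by apply: bmeasurableD; [exact: bln|exact: bmeasurable_cst].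
have Us : \int[lebesgue3]_(t in box) U s t = \int[lebesgue3]_(t in box) U 0 t.
  (* In the bound, 4 dominates |2x - 2 cos a| and the final 1 dominates |x|. *)
  apply: (@box_integral_constant _ U slope (- m) m
    (4 * ((1 - m) ^+ 2)^-1 + 1)) => //.
  - move=> x t /nm xm; have x1 := lt_trans xm m1.
    rewrite /U /slope; apply: is_der_eq.
      apply: is_derM; last exact: is_der_cst.
      apply: is_derD; last by repeat derive_step.
      apply: is_der_ln; first exact: poisson_denom_gt0.
      by rewrite /poisson_denom; repeat derive_step.
    by rewrite /=; field; exact/lt0r_neq0/poisson_denom_gt0.
  - move=> x t /nm xm; have x1 := lt_trans xm m1.
    rewrite /slope normrM -[leRHS]mulr1 ler_pM ?sphere_weight_le1//.
    apply: le_trans (ler_normB _ _) _; apply: lerD; last exact: ltW.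
    rewrite normrM ler_pM//.
      move: x1; rewrite ltr_norml => /andP[? ?].
      have := cos_le1 t.1.1; have := cos_geN1 t.1.1.
      by rewrite ler_norml; lra.
    have K0 := poisson_denom_gt0 t.1.1 x1.
    rewrite normfV (gtr0_norm K0) lef_pV2 ?posrE//.
      by apply: poisson_denom_ge => //; exact: ltW.
    by rewrite exprn_gt0// subr_gt0.
  - by move=> x /nm xm; apply: int_slope; exact: lt_trans m1.
  - by apply/andP; split; lra.
  - by apply/andP; split; lra.
have U0 : \int[lebesgue3]_(t in box) U 0 t = 0.
  rewrite (_ : U 0 = fun=> 0); first by rewrite /Rintegral integral0.
  apply/funext => t.
  rewrite /U (_ : poisson_denom 0 _ = 1); last by rewrite /poisson_denom; ring.
  by rewrite ln1 expr0n/= mul0r subrr mul0r.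
rewrite U0 in Us; rewrite /log_potential.
rewrite -RintegralZl; [|exact: measurable_sphere_box|]; last first.
  by apply: box_integrable; exact: bmeasurable_sphere_weight.
(* The difference of the two sides is the integral of [U s], which is zero. *)
apply/eqP; rewrite -subr_eq0; apply/eqP; rewrite -[RHS]Us.
have sm' : - m < s < m by apply/andP; split; lra.
rewrite -RintegralB; first 1 last.
- exact: measurable_sphere_box.
- apply: box_integrable; apply: bmeasurableM; last first.
    exact: bmeasurable_sphere_weight.
  rewrite (_ : (fun _ => _) = fun t : R3 => ln (poisson_denom s t.1.1)).
    exact: bln.
  apply/funext => t; rewrite /sphere_kernel /sphere_dot /quat /qt /qx /qy /qz/=.
  by rewrite /poisson_denom; congr ln; ring.
- apply: box_integrable; apply: bmeasurableM; first exact: bmeasurable_cst.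
  exact: bmeasurable_sphere_weight.
apply: eq_Rintegral => t _; rewrite /U.
rewrite (_ : sphere_kernel _ _ _ = poisson_denom s t.1.1); first by ring.
rewrite /sphere_kernel /sphere_dot /quat /qt /qx /qy /qz/=.
by rewrite /poisson_denom; ring.
Qed.

End scaling.

(** * Mean values over the sphere *)

Section mean_value.
Context {R : realType}.
Notation H := (quaternion R).
Notation mu := (@lebesgue_measure R).
Notation Rm := (measurableTypeR R).
Notation R3 := (Rm * Rm * Rm)%type.
Notation box := (sphere_box : set R3).

Lemma box_integralD (f g : R3 -> R) : bmeasurable f -> bmeasurable g ->
  \int[lebesgue3]_(t in box) (f t + g t) =
  \int[lebesgue3]_(t in box) f t + \int[lebesgue3]_(t in box) g t.
Proof.
move=> bf bg; apply: RintegralD; [|exact: box_integrable..].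
exact: measurable_sphere_box.
Qed.

Lemma box_integralZ (c : R) (f : R3 -> R) : bmeasurable f ->
  \int[lebesgue3]_(t in box) (c * f t) = c * \int[lebesgue3]_(t in box) f t.
Proof.
move=> bf; apply: RintegralZl; last exact: box_integrable.
exact: measurable_sphere_box.
Qed.

(** Additivity requires integrable partial sums, so the induction carries both facts. *)
Lemma box_integral_sum N (F : 'I_N -> R3 -> R) :
  (forall k, bmeasurable (F k)) ->
  bmeasurable (fun t => \sum_(k < N) F k t) /\
  \int[lebesgue3]_(t in box) (\sum_(k < N) F k t) =
  \sum_(k < N) \int[lebesgue3]_(t in box) F k t.
Proof.
elim: N F => [|N IH] F bF.
  under eq_fun do rewrite big_ord0.
  split; first exact: bmeasurable_cst.
  by rewrite big_ord0 /Rintegral integral0.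
have [bS SE] := IH (fun k => F (widen_ord (leqnSn N) k)) (fun k => bF _).
under eq_fun do rewrite big_ord_recr /=.
split; first exact: bmeasurableD.
by rewrite box_integralD// big_ord_recr /= SE.
Qed.

(** The angle is plus or minus acos(u / w), with w the radius and the sign that of [v]; at radius
    zero any angle serves. *)
Lemma polar_coordinates (u v : R) : exists phi,
  u = Num.sqrt (u ^+ 2 + v ^+ 2) * cos phi /\
  v = Num.sqrt (u ^+ 2 + v ^+ 2) * sin phi.
Proof.
have uv0 : 0 <= u ^+ 2 + v ^+ 2 by rewrite addr_ge0 ?sqr_ge0.
have := sqr_sqrtr uv0; have := sqrtr_ge0 (u ^+ 2 + v ^+ 2).
move: (Num.sqrt _) => w w0 w2.
have [w00|wn0] := eqVneq w 0.
  by exists 0; rewrite w00 in w2 *; rewrite !mul0r; split; nra.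
have {w0} w0 : 0 < w by rewrite lt0r wn0.
have uw : -1 <= u / w <= 1 by rewrite ler_pdivlMr// ler_pdivrMr//; nra.
have cE : u = w * cos (acos (u / w)) by rewrite acosK ?in_itv//=; field.
have sE : `|v| = w * sin (acos (u / w)).
  rewrite sin_acos// -{1}(gtr0_norm w0) -(sqrtr_sqr w) -sqrtrM ?sqr_ge0//.
  by rewrite -sqrtr_sqr; congr Num.sqrt; rewrite expr_div_n; field: w2.
have [v0|v0] := leP 0 v.
  by exists (acos (u / w)); rewrite -{}cE -sE ger0_norm.
exists (- acos (u / w)); rewrite cosN sinN mulrN -{}cE -sE ltr0_norm//.
by rewrite opprK.
Qed.

(* rotations of the three coordinate planes bring the pole to the real axis *)
Lemma log_potentialE (q : H) : qnorm q < 1 ->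
  log_potential (qnorm q) q =
  qnorm q ^+ 2 / 2 * \int[lebesgue3]_(t in box) sphere_weight t.
Proof.
move=> n1; have n0 : 0 <= qnorm q by exact: sqrtr_ge0.
case: q n0 n1 => [[[t x] y] z]; set n := qnorm _ => n0 n1.
have [c [yE zE]] := polar_coordinates y z; set w1 := Num.sqrt _ in yE zE.
have [b [xE w1E]] := polar_coordinates x w1; set w2 := Num.sqrt _ in xE w1E.
have [a [tE w2E]] := polar_coordinates t w2; set w3 := Num.sqrt _ in tE w2E.
have w12 : w1 ^+ 2 = y ^+ 2 + z ^+ 2 by rewrite sqr_sqrtr// addr_ge0 ?sqr_ge0.
have w22 : w2 ^+ 2 = x ^+ 2 + w1 ^+ 2 by rewrite sqr_sqrtr// addr_ge0 ?sqr_ge0.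
(* The radii accumulate one coordinate at a time, so the last one is the norm of the whole
   quaternion. *)
have w3n : w3 = n.
  rewrite /w3 w22 w12 /n /qnorm /qdot /qt /qx /qy /qz /= -!expr2.
  by congr Num.sqrt; ring.
have w32 : w3 ^+ 2 = t ^+ 2 + w2 ^+ 2 by rewrite sqr_sqrtr// addr_ge0 ?sqr_ge0.
transitivity (log_potential n (quat t x w1 0)).
  rewrite -(log_potential_rotation_yz n1 c) -?yE -?zE//.
  by rewrite -w3n; lra.
transitivity (log_potential n (quat t w2 0 0)).
  rewrite -(log_potential_rotation_xy n1 b) -?xE -?w1E//.
  by rewrite -w3n; lra.
transitivity (log_potential n (quat w3 0 0 0)).
  rewrite -(log_potential_rotation_tx n1 a) -?tE -?w2E//.
  by rewrite -w3n; lra.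
by rewrite w3n log_potential_axis// n0.
Qed.

Lemma box_volume : lebesgue3 box = (pi * pi * (2 * pi))%:E.
Proof.
transitivity ((mu \x mu) (`[0%R, pi] `*` `[0%R, pi]) *
    mu `[0%R, (2 * pi)%R])%E.
  apply: product_measure1E; last exact: measurable_itv.
  by apply: measurableX; exact: measurable_itv.
transitivity (mu `[0%R, pi] * mu `[0%R, pi] * mu `[0%R, (2 * pi)%R])%E.
  by congr (_ * _)%E; apply: product_measure1E; exact: measurable_itv.
have pi0 : (0 : R) < pi by exact: pi_gt0.
have itv_len (x : R) : 0 < x -> mu `[0%R, x] = x%:E.
  by move=> x0; rewrite lebesgue_measure_itv/= lte_fin x0 -EFinB subr0.
by rewrite !itv_len ?mulr_gt0.
Qed.

(* on the box, [sin a ^+ 2 * sin b] differs from the constant [pi^-1] by a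
   divergence *)
Lemma integral_sphere_weight_gt0 :
  0 < \int[lebesgue3]_(t in box) sphere_weight t.
Proof.
have pi0 : (0 : R) < pi by exact: pi_gt0.
(* On [0, pi] the mean of sin^2 is 1/2 and that of sin is 2/pi; subtracting them makes [f1] and [f2]
   exact derivatives with zero integral. *)
pose f1 (t : R3) := (sin t.1.1 ^+ 2 - 2^-1) * sin t.1.2.
pose f2 (t : R3) := 2^-1 * (sin t.1.2 - 2 / pi).
have bf1 : bmeasurable f1 by rewrite /f1; repeat bmeasurable_step.
have bf2 : bmeasurable f2 by rewrite /f2; repeat bmeasurable_step.
have int1 : \int[lebesgue3]_(t in box) f1 t = 0.
  apply: (@box_integral_derivative1 _
    (fun t => - 2^-1 * (sin t.1.1 * cos t.1.1) * sin t.1.2) f1 bf1).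
  - move=> a b c; rewrite /f1 /=; apply: is_der_eq; first by repeat derive_step.
    have c2 : cos a ^+ 2 = 1 - sin a ^+ 2 by rewrite -(cos2Dsin2 a); ring.
    by rewrite /=; field: c2.
  - by move=> b c; rewrite /f1 /=; repeat cts_step.
  - by move=> b c; rewrite /= sinpi sin0 !mul0r.
have int2 : \int[lebesgue3]_(t in box) f2 t = 0.
  apply: (@box_integral_derivative2 _
    (fun t => 2^-1 * (- cos t.1.2 - 2 / pi * t.1.2)) f2 bf2).
  - move=> a b c; rewrite /f2 /=; apply: is_der_eq; first by repeat derive_step.
    by rewrite /=; move: pi (lt0r_neq0 pi0) => p p0; field.
  - by move=> a c; rewrite /f2 /=; repeat cts_step.
  - move=> a c; rewrite /= cospi cos0.
    by move: pi (lt0r_neq0 pi0) => p p0; field.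
rewrite (_ : Rintegral _ _ _ =
    \int[lebesgue3]_(t in box) (f1 t + (f2 t + pi^-1))); last first.
  apply: eq_Rintegral => t _; rewrite /f1 /f2 /sphere_weight.
  by move: pi (lt0r_neq0 pi0) => p p0; field.
rewrite box_integralD//; last first.
  by apply: bmeasurableD => //; exact: bmeasurable_cst.
rewrite box_integralD//; last exact: bmeasurable_cst.
rewrite int1 int2 !add0r /Rintegral integral_cst//; last first.
  exact: measurable_sphere_box.
by rewrite box_volume/= mulr_gt0 ?invr_gt0// !mulr_gt0.
Qed.

End mean_value.

(** * Multiplicativity of the norm and logarithm of a PQL function *)

Section pql_norm.
Context {R : realType}.
Notation H := (quaternion R).
Implicit Types p q : H.

Lemma qdot_ge0 p : 0 <= qdot p p.
Proof. by rewrite /qdot -!expr2 !addr_ge0// sqr_ge0. Qed.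

(** Euler's four-square identity. *)
Lemma qnormM p q : qnorm (p * q) = qnorm p * qnorm q.
Proof.
rewrite /qnorm -sqrtrM ?qdot_ge0//; congr Num.sqrt.
rewrite -[p * q]/(qmul p q).
by rewrite /qmul /qdot /quat /qt /qx /qy /qz /=; ring.
Qed.

Lemma qnorm1 : qnorm (1 : H) = 1.
Proof.
rewrite /qnorm /qdot (_ : _ + _ = 1) ?sqrtr1//.
by rewrite -[1]/(@qone R) /qone /quat /qt /qx /qy /qz /= mulr1 !mul0r !addr0.
Qed.

Lemma qnorm_gt0 p : (0 < qnorm p) = (p != 0).
Proof. by rewrite /qnorm sqrtr_gt0 lt0r qdotpp_eq0 qdot_ge0 andbT. Qed.

Lemma quaternion_unitE p : (p \is a GRing.unit) = (p != 0).
Proof. by []. Qed.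

Lemma qnormV p : p != 0 -> qnorm p^-1 = (qnorm p)^-1.
Proof.
move=> p0; have np : qnorm p != 0 by rewrite gt_eqF// qnorm_gt0.
apply: (mulfI np); rewrite -qnormM mulfV// mulrV ?quaternion_unitE//.
exact: qnorm1.
Qed.

Lemma ln_qnormM p q : p != 0 -> q != 0 ->
  ln (qnorm (p * q)) = ln (qnorm p) + ln (qnorm q).
Proof. by move=> p0 q0; rewrite qnormM lnM// posrE qnorm_gt0. Qed.

Lemma quaternion_mulf_neq0 p q : p != 0 -> q != 0 -> p * q != 0.
Proof. by rewrite -!qnorm_gt0 qnormM; exact: mulr_gt0. Qed.

Lemma ln_qnorm_pm1 p (m : int) : p != 0 -> m = 1 \/ m = -1 ->
  p ^ m != 0 /\ ln (qnorm (p ^ m)) = m%:~R * ln (qnorm p).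
Proof.
move=> p0 [->|->]; first by rewrite expr1z mul1r.
rewrite exprN1 mulrN1z mulN1r -qnorm_gt0 qnormV// invr_gt0 qnorm_gt0 p0.
by rewrite lnV// posrE qnorm_gt0.
Qed.

(** The norm is multiplicative into a commutative ring, so the order of the factors is lost. Away
    from the [q k] no factor vanishes and the logarithm is additive. *)
Lemma ln_qnorm_pql N (a : 'I_N.+1 -> H) (q : 'I_N -> H) (M : 'I_N -> int) x :
  (forall k, M k = 1 \/ M k = -1) -> (forall k, a k != 0) ->
  (forall k, x != q k) ->
  ln (qnorm (pql a q M x)) = \sum_(h < N.+1) ln (qnorm (a h)) +
    \sum_(k < N) (M k)%:~R * ln (qnorm (x - q k)).
Proof.
move=> M1 a0 xq.
have xq0 k : x - q k != 0 by rewrite subr_eq0.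
have H k := ln_qnorm_pm1 (xq0 k) (M1 k).
rewrite /pql; set P := \prod_(_ < _) _.
have [P0 PE] : P != 0 /\ ln (qnorm P) =
    \sum_(k < N) (ln (qnorm (a (lift ord0 k))) +
                 (M k)%:~R * ln (qnorm (x - q k))).
  (* Nonvanishing of the partial products is carried along, since splitting the logarithm needs
     positive norms. *)
  apply: (big_rec2 (fun s p => p != 0 /\ ln (qnorm p) = s)).
    by rewrite oner_neq0 qnorm1 ln1.
  move=> k s p _ [p0 pE]; have [H0 HE] := H k.
  have Fk := quaternion_mulf_neq0 H0 (a0 (lift ord0 k)).
  split; first exact: quaternion_mulf_neq0.
  by rewrite !ln_qnormM// pE HE; ring.
rewrite ln_qnormM// PE big_split/= addrA.
by congr (_ + _); rewrite big_ord_recl.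
Qed.

Lemma measurable_qnorm_sub q : measurable_fun [set: H] (fun y : H => qnorm (y - q)).
Proof.
have m1 : measurable_fun [set: H] (fun y : H => y.1) by exact: measurable_fst.
have m11 : measurable_fun [set: H] (fun y : H => y.1.1).
  exact: (measurableT_comp measurable_fst m1).
have mt : measurable_fun [set: H] (@qt R).
  exact: (measurableT_comp measurable_fst m11).
have mx : measurable_fun [set: H] (@qx R).
  exact: (measurableT_comp measurable_snd m11).
have my : measurable_fun [set: H] (@qy R).
  exact: (measurableT_comp measurable_snd m1).
have mz : measurable_fun [set: H] (@qz R) by exact: measurable_snd.
have ms : measurable_fun [set: R] (Num.sqrt : R -> R).
  by apply: continuous_measurable_fun; exact: sqrt_continuous.
apply: (measurableT_comp (g := fun y : H => (qt y - qt q) * (qt y - qt q) +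
    (qx y - qx q) * (qx y - qx q) + (qy y - qy q) * (qy y - qy q) +
    (qz y - qz q) * (qz y - qz q)) ms).
have msub (u : H -> R) c : measurable_fun [set: H] u ->
    measurable_fun [set: H] (fun y => (u y - c) * (u y - c)).
  by move=> mu; apply: measurable_funM; apply: measurable_funB.
by do 3 (apply: measurable_funD; last exact: msub); exact: msub.
Qed.

Lemma measurable_qsphere (rho : R) : measurable (qsphere rho : set H).
Proof.
have := measurable_qnorm_sub 0 => /(_ measurableT [set rho] (measurable_set1 _)).
rewrite setTI (_ : _ @^-1` _ = qsphere rho)//.
by apply/seteqP; split => y; rewrite /qsphere /= subr0.
Qed.

End pql_norm.

(** * From the sphere of radius [rho] to the coordinate box *)

Section sphere_mean.
Context {R : realType}.
Notation H := (quaternion R).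
Notation Rm := (measurableTypeR R).
Notation R3 := (Rm * Rm * Rm)%type.
Notation box := (sphere_box : set R3).
Variables (rho : R) (rho0 : 0 < rho).

(** The area of the unit sphere, kept symbolic because it cancels in the mean. *)
Let mass : R := \int[lebesgue3]_(t in box) sphere_weight t.

Let qsphere_param t : qsphere rho (sphere_param rho t).
Proof. by rewrite /qsphere /= qnorm_sphere_param// ltW. Qed.

Lemma area_element_box t : box t ->
  area_element (sphere_param rho) t = rho ^+ 3 * sphere_weight t.
Proof.
case: t => [[a b] c] [[_ /=]]; rewrite in_itv/= => /sin_ge0_pi sb _.
by rewrite sphere_area_element gtr0_norm// ger0_norm// -mulrA.
Qed.

Lemma box_integral_EFin (f : R3 -> R) : bmeasurable f ->
  (\int[lebesgue3]_(t in box) (f t)%:E)%E =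
  (\int[lebesgue3]_(t in box) f t)%:E.
Proof.
move=> bf; rewrite /Rintegral fineK//; apply: integrable_fin_num.
  exact: measurable_sphere_box.
exact: box_integrable.
Qed.

Lemma sphere_measure_qsphere :
  sphere_measure rho (qsphere rho) = (rho ^+ 3 * mass)%:E.
Proof.
rewrite /sphere_measure (_ : _ `&` _ = box); last first.
  by apply/seteqP; split => [t []|t ?]//; split=> //; exact: qsphere_param.
have bW : bmeasurable (fun t : R3 => rho ^+ 3 * sphere_weight t).
  by apply: bmeasurableM; [exact: bmeasurable_cst|exact: bmeasurable_sphere_weight].
rewrite /mass -box_integralZ//; last exact: bmeasurable_sphere_weight.
rewrite -box_integral_EFin//; apply: eq_integral => t /[!inE] bt.
by rewrite area_element_box.
Qed.

Lemma integral_sphere_measure (f : H -> R) : measurable_fun [set: H] f ->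
  (\int[sphere_measure rho]_(y in qsphere rho) (f y)%:E =
   \int[lebesgue3]_(t in box)
     (f (sphere_param rho t) * (rho ^+ 3 * sphere_weight t))%:E)%E.
Proof.
move=> mf; have mJ := @measurable_area_element R rho.
rewrite (@integral_density _ _ _ _ _ lebesgue3 (sphere_measure rho)
  (sphere_param rho) _ box _ (area_element (sphere_param rho)))//.
- apply: eq_integral => t /[!inE] bt.
  by rewrite area_element_box// -EFinM.
- exact: measurable_sphere_param.
- exact: measurable_sphere_box.
- exact: measurable_funTS.
- by move=> t; exact: sqrtr_ge0.
- exact: measurable_qsphere.
- exact/measurable_EFinP.
Qed.

Let qscale (q : H) : H := quat (qt q / rho) (qx q / rho) (qy q / rho) (qz q / rho).

Let qnorm_qscale q : qnorm (qscale q) = qnorm q / rho.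
Proof.
rewrite /qnorm -[in RHS](gtr0_norm rho0) -sqrtr_sqr -sqrtrV ?sqr_ge0//.
rewrite -sqrtrM ?qdot_ge0//; congr Num.sqrt.
rewrite /qscale /qdot /quat /qt /qx /qy /qz /=; field.
exact: lt0r_neq0.
Qed.

Let qnorm_qscale_lt1 q : qnorm q < rho -> qnorm (qscale q) < 1.
Proof. by move=> qr; rewrite qnorm_qscale ltr_pdivrMr// mul1r. Qed.

(** For a unit vector w, |rho w - q|^2 = rho^2 |w - q/rho|^2, and the second factor is the kernel of
    the rescaled pole. *)
Lemma ln_qnorm_sphere_param_sub q t : qnorm q < rho ->
  ln (qnorm (sphere_param rho t - q)) =
  ln rho + ln (sphere_kernel (qnorm (qscale q)) (qscale q) t) / 2.
Proof.
case: t => [[a b] c] qr; set K := sphere_kernel _ _ _.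
have K0 : 0 < K by apply: sphere_kernel_gt0 => //; exact: qnorm_qscale_lt1.
have -> : qnorm (sphere_param rho (a, b, c) - q) = rho * Num.sqrt K.
  rewrite -{2}(gtr0_norm rho0) -sqrtr_sqr -sqrtrM ?sqr_ge0// /qnorm.
  congr Num.sqrt; rewrite /K /sphere_kernel sqr_sqrtr ?qdot_ge0//.
  have := @qnorm_sphere_param R 1 (a, b, c) ler01; rewrite /qnorm => h.
  have := sqr_sqrtr (qdot_ge0 (sphere_param 1 (a, b, c))); rewrite h expr1n => p1.
  rewrite {1}p1 sphere_dotE {h p1}.
  rewrite /qscale /qdot /quat /qt /qx /qy /qz /=; field.
  exact: lt0r_neq0.
have sK : 0 < Num.sqrt K by rewrite sqrtr_gt0.
rewrite lnM ?posrE//; congr (_ + _).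
by rewrite -{2}(sqr_sqrtr (ltW K0)) expr2 lnM ?posrE//; field.
Qed.

(** By [log_potentialE] the logarithm of the kernel has mean |q|^2 / (2 rho^2); passing from the
    squared norm to the norm halves it. *)
Lemma mean_ln_qnorm_sub q : qnorm q < rho ->
  bmeasurable (fun t : R3 =>
    ln (qnorm (sphere_param rho t - q)) * (rho ^+ 3 * sphere_weight t)) /\
  \int[lebesgue3]_(t in box)
    (ln (qnorm (sphere_param rho t - q)) * (rho ^+ 3 * sphere_weight t)) =
  (ln rho + qnorm q ^+ 2 / (4 * rho ^+ 2)) * (rho ^+ 3 * mass).
Proof.
move=> qr; have n1 := qnorm_qscale_lt1 qr.
have bL := bmeasurable_ln_sphere_kernel n1 (lexx _).
have bW := @bmeasurable_sphere_weight R.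
pose K t := ln (sphere_kernel (qnorm (qscale q)) (qscale q) t) * sphere_weight t.
have bK : bmeasurable K by exact: bmeasurableM.
rewrite (_ : (fun t => _) =
    fun t => rho ^+ 3 * ln rho * sphere_weight t + rho ^+ 3 / 2 * K t).
  have b1 : bmeasurable (fun t : R3 => rho ^+ 3 * ln rho * sphere_weight t).
    by apply: bmeasurableM => //; exact: bmeasurable_cst.
  have b2 : bmeasurable (fun t : R3 => rho ^+ 3 / 2 * K t).
    by apply: bmeasurableM => //; exact: bmeasurable_cst.
  split; first exact: bmeasurableD.
  rewrite box_integralD// !box_integralZ//.
  have := log_potentialE n1; rewrite /log_potential -/mass => ->.
  rewrite qnorm_qscale; field; exact: lt0r_neq0.
by apply/funext => t; rewrite ln_qnorm_sphere_param_sub// /K; field.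
Qed.

End sphere_mean.

Theorem corollary3p13 (R : realType) (rho : R) (N : nat)
    (a : 'I_N.+1 -> quaternion R) (q : 'I_N -> quaternion R) (M : 'I_N -> int)
    (rho_gt0 : 0 < rho)
    (M_pm1 : forall k, M k = 1 \/ M k = -1)
    (q_in : forall k, 0 < qnorm (q k) < rho)
    (a_neq0 : forall k, a k != 0) :
  ((sphere_measure rho (qsphere rho))^-1 *
     \int[sphere_measure rho]_(y in qsphere rho) (ln (qnorm (pql a q M y)))%:E)%E
  = (rho ^+ 2 / 8 * (\sum_(k < N) (M k)%:~R * (2 / qnorm (q k) ^+ 2))
     + \sum_(h < N.+1) ln (qnorm (a h))
     + \sum_(k < N) (M k)%:~R *
         (ln rho + 1 / 4 * ((qnorm (q k) ^+ 4 - rho ^+ 4)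
                            / (rho ^+ 2 * qnorm (q k) ^+ 2))))%:E.
Proof.
have mass_gt0 := @integral_sphere_weight_gt0 R.
set J := Rintegral _ _ _ in mass_gt0.
have T0 : 0 < rho ^+ 3 * J by rewrite mulr_gt0 ?exprn_gt0.
have qlt k : qnorm (q k) < rho by have /andP[] := q_in k.
pose c := \sum_(h < N.+1) ln (qnorm (a h)).
(* A function measurable on the whole space, as the change of variables requires; it agrees with the
   integrand on the sphere. *)
pose f (y : quaternion R) := c + \sum_(k < N) (M k)%:~R * ln (qnorm (y - q k)).
have mf : measurable_fun [set: quaternion R] f.
  apply: measurable_funD => //; apply: measurable_sum => k.
  apply: measurable_funM => //; apply: measurableT_comp => //.
  exact: measurable_qnorm_sub.
have -> : (\int[sphere_measure rho]_(y in qsphere rho)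
      (ln (qnorm (pql a q M y)))%:E =
    \int[sphere_measure rho]_(y in qsphere rho) (f y)%:E)%E.
  apply: eq_integral => y /[!inE]; rewrite /qsphere/= => yr.
  rewrite ln_qnorm_pql// => k; apply: contraTneq (qlt k) => <-.
  by rewrite yr ltxx.
rewrite integral_sphere_measure// sphere_measure_qsphere// -/J.
pose g k (t : measurableTypeR R * measurableTypeR R * measurableTypeR R) :=
  ln (qnorm (sphere_param rho t - q k)) * (rho ^+ 3 * sphere_weight t).
have bg k : bmeasurable (g k) by case: (mean_ln_qnorm_sub rho_gt0 (qlt k)).
have gE k := (mean_ln_qnorm_sub rho_gt0 (qlt k)).2.
have bW := @bmeasurable_sphere_weight R.
have bMg k : bmeasurable (fun t => (M k)%:~R * g k t).
  by apply: bmeasurableM => //; exact: bmeasurable_cst.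
have [bS SE] := box_integral_sum bMg.
have bc : bmeasurable (fun t : measurableTypeR R * measurableTypeR R *
    measurableTypeR R => c * rho ^+ 3 * sphere_weight t).
  by apply: bmeasurableM => //; exact: bmeasurable_cst.
under eq_integral => t _.
  rewrite (_ : _ * _ = c * rho ^+ 3 * sphere_weight t +
      \sum_(k < N) (M k)%:~R * g k t); last first.
    rewrite /f /g mulrDl mulrA; congr (_ + _); rewrite mulr_suml.
    by apply: eq_bigr => k _; rewrite -mulrA.
  over.
rewrite box_integral_EFin; last exact: bmeasurableD.
(* The total mass is a nonzero real, so its extended inverse is the real one and the identity
   descends to the reals. *)
rewrite box_integralD// box_integralZ// SE -/J inver gt_eqF// -EFinM.
congr (_%:E).
rewrite (eq_bigr (fun k => (M k)%:~R *
    (ln rho + qnorm (q k) ^+ 2 / (4 * rho ^+ 2)) * (rho ^+ 3 * J))); last first.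
  by move=> k _; rewrite box_integralZ// gE -/J mulrA.
rewrite -mulr_suml -mulrA -mulrDl mulrC mulfK ?gt_eqF//.
rewrite mulr_sumr -/c addrAC (addrC c) -big_split/=; congr (_ + _).
(* The terms rho^2 / (4 |q_k|^2) of the two sums in the statement cancel, leaving |q_k|^2 / (4
   rho^2); the division uses that [q k] is nonzero. *)
apply: eq_bigr => k _; have /andP[q0 _] := q_in k.
by field; rewrite !lt0r_neq0.
Qed.
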